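(* For $n\ge1$ and probability distributions $P_1,\dots,P_n$ in a family $\mathcal{P}$ (not necessarily distinct), let $\mathbb{P}_n=\mathbb{E}_{\pi\sim\mathrm{Unif}(S_n)}\left[\otimes_{i=1}^n P_{\pi(i)}\right]$ and $\mathbb{Q}_n=\left(\frac1n\sum_{i=1}^n P_i\right)^{\otimes n}$. The following hold, where all constants hidden in $O(\cdot)$ are absolute (in particular independent of $n$, of the choice of $P_1,\dots,P_n\in\mathcal{P}$, and of the parameters of the family). 1. Gaussian family $\mathcal{P}=\{\mathcal{N}(\theta,1):|\theta|\le\mu\}$, $\mu>0$: there exists an absolute constant $\mu_c>0$ such that $$\chi^2(\mathbb{P}_n\|\mathbb{Q}_n)=\begin{cases}O(\mu^4)&\text{if }\mu\le\mu_c,\\ \exp(O(\mu^3))-1&\text{if }\mu>\mu_c.\end{cases}$$ 2. Gaussian family with small support $\mathcal{P}=\{\mathcal{N}(\theta,1):|\theta|\le\mu,\ \theta\in\Theta\}$ with $|\Theta|<\infty$: there exists an absolute constant $\mu_c>0$ such that $$\chi^2(\mathbb{P}_n\|\mathbb{Q}_n)=\begin{cases}O(\mu^4)&\text{if }\mu\le\mu_c,\\ \exp(O(|\Theta|\mu^2))-1&\text{if }\mu>\mu_c.\end{cases}$$ 3. Bernoulli family $\mathcal{P}=\{\mathrm{Bern}(p):p\in[\varepsilon,1-\varepsilon]\}$: there exists an absolute constant $\varepsilon_c\in(0,1/2)$ such that $$\chi^2(\mathbb{P}_n\|\mathbb{Q}_n)=\begin{cases}O((1-2\varepsilon)^4)&\text{if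 }\varepsilon\ge\varepsilon_c,\\ O\left(\frac1\varepsilon\right)&\text{if }0<\varepsilon<\varepsilon_c.\end{cases}$$ 4. Poisson family $\mathcal{P}=\{\mathrm{Poi}(\lambda):\lambda\in[0,M]\}$: $$\chi^2(\mathbb{P}_n\|\mathbb{Q}_n)=\begin{cases}O(M^2)&\text{if }M\le1,\\ \exp\left(O(M^{3/2})\right)-1&\text{if }M>1.\end{cases}$$
   Context: $S_n$ is the permutation group of $\{1,\dots,n\}$, and $\mathrm{Unif}$ denotes the uniform distribution. $\chi^2(P\|Q)=\int\frac{(\mathrm{d}P-\mathrm{d}Q)^2}{\mathrm{d}Q}$. $\mathcal{N}(\theta,1)$ is the normal distribution with mean $\theta$ and variance $1$, $\mathrm{Bern}(p)$ the Bernoulli distribution, $\mathrm{Poi}(\lambda)$ the Poisson distribution. In item 3, $\varepsilon\in(0,1/2]$. *)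

(* Defs.v *)
From HB Require Import structures.
From mathcomp Require Import all_boot all_order all_algebra all_fingroup.
From mathcomp Require Import finmap.
From mathcomp Require Import all_classical all_reals all_analysis.

Set Implicit Arguments.
Unset Strict Implicit.
Unset Printing Implicit Defensive.

Import Order.TTheory GRing.Theory Num.Theory.
Import numFieldNormedType.Exports.

Local Open Scope classical_set_scope.
Local Open Scope ring_scope.
Local Open Scope charge_scope.
Local Open Scope ereal_scope.

Section chi2.
Context d (T : measurableType d) (R : realType).

(* \int (dP - dQ)^2 / dQ = \int (dP/dQ - 1)^2 dQ, with the usual convention
   that the value is +oo when P is not absolutely continuous w.r.t. Q. *)
Definition chi2 (P Q : probability T R) : \bar R :=
  if `[< P `<< Q >] then
    \int[Q]_x (('d (charge_of_finite_measure P) '/d Q) x - 1) ^+ 2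
  else +oo.

End chi2.

Section unif_mixture.
Context d (T : measurableType d) (R : realType).

(* The law of a sample from F i with i uniform on I. The point i0 only
   witnesses that I is nonempty, so that the result is a probability. *)
Definition unif_mixture (I : finType) (i0 : I) (F : I -> probability T R) :
    set T -> \bar R :=
  fun A => (#|I|%:R^-1)%:E * \sum_(i : I) F i A.

Section instance.
Variables (I : finType) (i0 : I) (F : I -> probability T R).
Local Notation mix := (unif_mixture i0 F).

Let mix0 : mix set0 = 0.
Proof.
by rewrite /unif_mixture big1 ?mule0// => i _; rewrite measure0.
Qed.

Let mix_ge0 A : 0 <= mix A.
Proof. by rewrite mule_ge0// ?lee_fin ?invr_ge0// sume_ge0. Qed.

Let mix_sigma_additive : semi_sigma_additive mix.
Proof.
move=> A mA tA mUA; rewrite /unif_mixture.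
rewrite [X in X @ _ --> _](_ : _ =
    fun n => (#|I|%:R^-1)%:E * \sum_(i : I) \sum_(0 <= k < n) F i (A k)).
  apply: cvgeZl => //.
  apply: cvg_nnesum => [i _|i _].
    by near=> n; exact: sume_ge0.
  exact: measure_semi_sigma_additive.
apply/funext => n; rewrite exchange_big/= ge0_sume_distrr//.
by move=> k _; exact: sume_ge0.
Unshelve. all: by end_near. Qed.

HB.instance Definition _ :=
  isMeasure.Build _ _ _ mix mix0 mix_ge0 mix_sigma_additive.

Let mixT : mix [set: T] = 1.
Proof.
rewrite /unif_mixture (eq_bigr (fun=> (1%R)%:E)); last first.
  by move=> i _; rewrite probability_setT.
rewrite sumEFin -EFinM sumr_const cardT -cardE mulVf//.
by rewrite pnatr_eq0 -lt0n; apply/card_gt0P; exists i0.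
Qed.

HB.instance Definition _ := Measure_isProbability.Build _ _ _ mix mixT.

End instance.
End unif_mixture.

Section product.
Context d (T : measurableType d) (R : realType).

Definition tcons n (x : T * n.-tuple T) : n.+1.-tuple T :=
  [tuple of x.1 :: x.2].

Lemma measurable_tcons n : measurable_fun [set: T * n.-tuple T] (@tcons n).
Proof. exact: measurable_cons. Qed.

HB.instance Definition _ n :=
  isMeasurableFun.Build _ _ _ _ (@tcons n) (@measurable_tcons n).

(* The (non necessarily identical) product measure on n.-tuple T, which the
   library endows with the sigma-algebra generated by the coordinates. *)
Fixpoint prod_prob n : ('I_n -> probability T R) -> probability (n.-tuple T) R :=
  match n with
  | 0 => fun _ => \d_([tuple] : 0.-tuple T)
  | n'.+1 => fun P =>
      distribution (P ord0 \x prod_prob (fun i => P (lift ord0 i))) (@tcons n')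
  end.

Lemma prod_prob_rect n (P : 'I_n -> probability T R) (A : 'I_n -> set T) :
  (forall i, measurable (A i)) ->
  prod_prob P [set x | forall i, A i (tnth x i)] = \prod_(i < n) P i (A i).
Proof.
elim: n P A => [|n IH] P A mA.
  rewrite big_ord0 /= diracE mem_set//; by case.
rewrite big_ord_recl -IH//= /distribution /pushforward -product_measure1E//.
  congr (_ _); apply/seteqP; split => [x /= h|[x y] /= [h0 h] i].
    by split=> [|i]; [exact: (h ord0)|have := h (lift ord0 i); rewrite tnthS].
  by case: (unliftP ord0 i) => [j|] ->; rewrite ?tnthS//; exact: h.
rewrite (_ : [set _ | _] = \bigcap_(i in [set: 'I_n])
  ((@tnth n T)^~ i @^-1` (A (lift ord0 i)))).
  apply: fin_bigcap_measurable => // i _.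
  by rewrite -[X in measurable X]setTI; exact: measurable_tnth.
by apply/seteqP; split => [x h i _|x h i]; [exact: h|exact: h].
Qed.

(* E_{pi ~ Unif(S_n)} [P_{pi(1)} \x ... \x P_{pi(n)}], for a size n >= 1
   presented as a successor. *)
Definition permuted_prod n (P : 'I_n.+1 -> probability T R) :
    probability (n.+1.-tuple T) R :=
  unif_mixture (1%g : 'S_n.+1) (fun pi => prod_prob (fun i => P (pi i))).

Definition iid_mean_prod n (P : 'I_n.+1 -> probability T R) :
    probability (n.+1.-tuple T) R :=
  prod_prob (fun _ : 'I_n.+1 => unif_mixture (ord0 : 'I_n.+1) P).

(* A uniform bound over all sizes n >= 1 and all choices of P_1, ..., P_n
   in the family. *)
Definition perm_chi2_le (family : set (probability T R)) (B : R) : Prop :=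
  forall (n : nat) (P : 'I_n.+1 -> probability T R),
    (forall i, family (P i)) ->
    chi2 (permuted_prod P) (iid_mean_prod P) <= B%:E.

End product.

Section families.
Context {R : realType}.
Local Open Scope ring_scope.

Definition gaussian (theta : R) : probability _ R := normal_prob theta 1.

Definition bern (p : R) : probability bool R := bernoulli_prob p.

(* The second argument of poisson_prob is unused. *)
Definition poi (lambda : R) : probability nat R := poisson_prob lambda 0%N.

Definition gaussian_family (mu : R) :=
  [set gaussian theta | theta in [set theta | `|theta| <= mu]].

Definition gaussian_subfamily (mu : R) (Theta : {fset R}) :=
  [set gaussian theta | theta in [set theta | `|theta| <= mu /\ theta \in Theta]].

Definition bernoulli_family (eps : R) :=
  [set bern p | p in [set p | eps <= p <= 1 - eps]].

Definition poisson_family (M : R) :=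
  [set poi lambda | lambda in [set lambda | 0 <= lambda <= M]].

End families.

(* Main.v *)
(* Let f_i be the density of P_i with respect to the mean Pbar of the P_i, and
   let A be the n x n matrix with entries (1/n) \int f_i f_j dPbar. It is doubly
   stochastic and positive semidefinite, and 1 + chi^2 = (n^n / n!) per(A).

   Write A = J/n + B, where J/n is the projection onto the constants, and let
   F(t) = (n^n / n!) per(J/n + t B). The permanent of a Gram matrix is
   E \prod_i |Z_i|^2 for a centred complex Gaussian vector Z with that
   covariance; by AM-GM, it is at most n^-n E (\sum_i |Z_i|^2)^n, and
   \sum_i |Z_i|^2 is a combination of independent exponential variables whose
   weights are 1 and the eigenvalues of t B. Computing the moment gives
   F(t) <= \prod_k (1 - t lambda_k)^-1, with lambda_k the eigenvalues of B.

   The coefficients of F are nonnegative, its constant term is 1 and its linear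
   term vanishes, so F(1) - 1 <= (F(t) - 1) / t^2 for t >= 1. With
   tau = tr B <= 1/2 and t = 1/(2 tau) this gives chi^2 <= 4 tau^2, which is the
   bound for small parameters. For large ones, F(1) is bounded at t = 1 either
   by (1 - tau)^-1, or by exp(2 (1 + L) tau) when every entry of n A is at least
   exp(-L). Finally, 1 + tau is at most the integral of any function dominating
   all the densities, and at most 1 + max_{i,j} chi^2(P_i || P_j), while the
   entries of n A are bounded below by squared Hellinger affinities. *)

Require Import Defs.
From mathcomp Require Import all_boot all_order all_algebra all_fingroup.
From mathcomp Require Import finmap complex cyclotomic separable cyclic.
From mathcomp Require Import sesquilinear spectral.
From mathcomp Require Import all_classical all_reals all_analysis measurable_realfun.
From mathcomp Require Import ring lra.

Set Implicit Arguments.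
Unset Strict Implicit.
Unset Printing Implicit Defensive.

Import Order.TTheory GRing.Theory Num.Theory.
Import numFieldNormedType.Exports.
Local Open Scope classical_set_scope.
Local Open Scope ring_scope.

(** * Gaussian moments as a positive functional *)

Section laplace.
Context {R : realType}.
Implicit Types p q : {poly R}.

(** For [1 <= x] the polynomial is at most [S * x ^+ d], while [expR x] exceeds [x ^+ d.+1 / K]. At
    [x = 1 + S * K / c] the latter, multiplied by [c], wins. *)
Lemma expR_not_le_horner p (c : R) : 0 < c ->
  ~ (forall x, 0 <= x -> c * expR x <= p.[x]).
Proof.
move=> c0 H.
pose S := \sum_(i < size p) `|p`_i|.
have S0 : 0 <= S by apply: sumr_ge0.
pose d := size p; pose K := d.+1`!%:R : R.
have K0 : 0 < K by rewrite /K ltr0n fact_gt0.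
pose y := S * K / c.
have y0 : 0 <= y by rewrite divr_ge0 ?mulr_ge0// ltW.
pose x := 1 + y.
have x1 : 1 <= x by rewrite lerDl.
have x0 : 0 <= x by rewrite (le_trans _ x1).
have hp : p.[x] <= S * x ^+ d.
  rewrite horner_coef mulr_suml; apply: ler_sum => i _.
  apply: (le_trans (ler_norm _)); rewrite normrM ler_wpM2l//.
  by rewrite ger0_norm ?exprn_ge0// ler_weXn2l// ltnW.
have := H x x0; apply/negP; rewrite -ltNge.
apply: (le_lt_trans hp).
have h1 := expR_ge1Dxn d x0.
have e1 : c * (x ^+ d.+1 / K) = x ^+ d * (c / K) + S * x ^+ d.
  by rewrite exprS /x /y; field; rewrite !gt_eqF.
have h2 : c * (1 + x ^+ d.+1 / K) <= c * expR x by rewrite ler_pM2l.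
apply: lt_le_trans h2; rewrite mulrDr mulr1 e1.
have : 0 <= x ^+ d * (c / K) by rewrite mulr_ge0 ?exprn_ge0// divr_ge0// ltW.
lra.
Qed.

(* [q] is the solution [q - q' = p] vanishing against [expR (- x)] at infinity,
   so that [q.[0]] is the integral of [p x * expR (- x)] over the half-line. *)
Lemma sum_coef_fact_ge0 p : (forall x, 0 <= x -> 0 <= p.[x]) ->
  0 <= \sum_(i < size p) p`_i * i`!%:R.
Proof.
move=> p0; pose q := \sum_(i < size p) p^`(i).
have q00 : q.[0] = \sum_(i < size p) p`_i * i`!%:R.
  rewrite horner_sum; apply: eq_bigr => i _.
  by rewrite horner_coef0 coef_derivn addn0 ffactnn mulr_natr.
have qq : q - q^`() = p.
  rewrite /q raddf_sum/= -sumrB.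
  under eq_bigr do rewrite -derivnS.
  rewrite -(big_mkord xpredT (fun i => p^`(i) - p^`(i.+1))).
  rewrite (telescope_sumr_eq (fun i => - p^`(i)))//; last first.
    by move=> i _; rewrite opprK addrC.
  by rewrite derivn_poly0// oppr0 sub0r opprK.
rewrite -q00 leNgt; apply/negP => q0.
pose g (x : R) := q.[x] * expR (- x).
have dg (x : R) : is_derive x 1 g (- p.[x] * expR (- x)).
  have dq : is_derive x 1 (horner q) q^`().[x].
    exact: is_derive_poly.
  have de : is_derive x 1 (fun x : R => expR (- x)) (- expR (- x)).
    apply: is_derive_eq; rewrite /GRing.scale/=; ring.
  apply: is_derive_eq; rewrite /GRing.scale/= -[in RHS]qq hornerD hornerN; ring.
have gdec (x : R) : 0 <= x -> g x <= g 0.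
  move=> x0; apply: (@ler0_derive1_nincry _ g 0) => //.
  - move=> y; rewrite in_itv/= andbT => y0.
    rewrite derive1E derive_val mulNr oppr_le0 mulr_ge0 ?expR_ge0// p0// ltW//.
  - apply: continuous_subspaceT => y.
    by apply/differentiable_continuous/derivable1_diffP; have [h _] := dg y; exact: h.
(* If [q.[0]] were negative, the decrease of [g] would keep [- q] above a positive multiple of
   [expR] on the whole half-line. *)
apply: (@expR_not_le_horner (- q) (- q.[0])); first by rewrite oppr_gt0.
move=> x x0; have := gdec x x0; rewrite /g oppr0 expR0 mulr1 hornerN => h.
rewrite mulNr lerN2 -ler_pdivrMr ?expR_gt0//.
by rewrite -expRN.
Qed.

(** Same positivity for a sum in which several indices may share an exponent: grouping them by
    degree gives a polynomial. *)
Lemma sum_fact_ge0 (T : finType) (c : T -> R) (a : T -> nat) :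
  (forall x, 0 <= x -> 0 <= \sum_t c t * x ^+ a t) ->
  0 <= \sum_t c t * (a t)`!%:R.
Proof.
move=> H; pose p : {poly R} := \sum_t c t *: 'X^(a t).
suff <- : \sum_(i < size p) p`_i * i`!%:R = \sum_t c t * (a t)`!%:R.
  apply: sum_coef_fact_ge0 => x x0; rewrite horner_sum.
  under eq_bigr do rewrite hornerZ hornerXn.
  exact: H.
pose N := (maxn (size p) (\max_t (a t).+1))%N.
have -> : \sum_(i < size p) p`_i * i`!%:R = \sum_(i < N) p`_i * i`!%:R.
  rewrite (big_ord_widen N (fun i => p`_i * i`!%:R)) ?leq_maxl// big_mkcond/=.
  by apply: eq_bigr => i _; case: ltnP => // /(nth_default 0)->; rewrite mul0r.
under eq_bigr do rewrite coef_sum mulr_suml.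
rewrite exchange_big/=; apply: eq_bigr => t _.
have aN : (a t < N)%N by rewrite leq_max (@leq_bigmax _ (fun t => (a t).+1))// orbT.
rewrite (bigD1 (Ordinal aN))//= coefZ coefXn eqxx mulr1 big1 ?addr0// => i.
by rewrite -val_eqE/= => /negbTE ne; rewrite coefZ coefXn ne mulr0 mul0r.
Qed.

End laplace.

(** * Moments of a standard complex Gaussian *)

Section complex_gaussian.
Context {R : realType}.
Local Notation C := R[i].

(** ['X^n - 1] splits and is separable, so it has [n] distinct roots, and [n] distinct [n]-th roots
    of unity in a field include a primitive one. *)
Lemma complex_prim_root n : (0 < n)%N -> exists z : C, n.-primitive_root z.
Proof.
pose p : {poly C} := 'X^n - 1; have [r Dp] := closed_field_poly_normal p.
move=> n_gt0; rewrite (monicP _) ?monicXnsubC // scale1r in Dp.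
have rn1: all n.-unity_root r by apply/allP=> z; rewrite -root_prod_XsubC -Dp.
have sz_r: (n < (size r).+1)%N.
  by rewrite -(size_prod_XsubC r id) -Dp size_XnsubC.
have [|z] := hasP (cyclic.has_prim_root n_gt0 rn1 _ sz_r); last by exists z.
by rewrite -separable_prod_XsubC -Dp separable_Xn_sub_1 // pnatr_eq0 -lt0n.
Qed.

Lemma sum_complexE (I : finType) (w : I -> C) :
  \sum_i w i = Complex (\sum_i complex.Re (w i)) (\sum_i complex.Im (w i)).
Proof.
elim/big_rec3: _ => //= i x y z _ ->.
by case: (w i).
Qed.

Lemma prim_root_conj n (w : C) : n.-primitive_root w -> w * w^* = 1.
Proof.
move=> prw; have n0 := prim_order_gt0 prw.
have : `|w| = 1.
  apply/eqP; rewrite -(@pexpr_eq1 _ _ n)//.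
  by rewrite -normrX (prim_expr_order prw) normr1.
by rewrite -normCK => ->; rewrite expr1n.
Qed.

(** Orthogonality of characters: for [a != b] the number [u] is an [n]-th root of unity other than
    1, so its geometric sum vanishes. *)
Lemma sum_prim_root n (w : C) (a b : nat) : n.-primitive_root w ->
  (a < n)%N -> (b < n)%N ->
  \sum_(j < n) (w ^+ j) ^+ a * ((w ^+ j)^*) ^+ b = n%:R * (a == b)%:R.
Proof.
move=> prw an bn; have ww := prim_root_conj prw.
pose u := w ^+ a * w^* ^+ b.
have -> : \sum_(j < n) (w ^+ j) ^+ a * ((w ^+ j)^*) ^+ b = \sum_(j < n) u ^+ j.
  apply: eq_bigr => j _; rewrite rmorphXn/= exprMn; congr (_ * _).
    by rewrite -!exprM mulnC.
  by rewrite -!exprM mulnC.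
have [ab|/eqP ab] := eqVneq a b.
  rewrite ab in u *; rewrite /u -exprMn ww expr1n.
  under eq_bigr do rewrite expr1n.
  by rewrite sumr_const card_ord mulr1.
have u1 : u - 1 != 0.
  rewrite subr_eq0; apply/eqP => u1; apply: ab.
  have : w ^+ a = w ^+ b.
    have := congr1 (fun x => x * w ^+ b) u1; rewrite /u mul1r -mulrA -exprMn.
    by rewrite [w^* * w]mulrC ww expr1n mulr1.
  move/eqP; rewrite (eq_prim_root_expr prw) => /eqP.
  by rewrite !modn_small.
apply: (mulfI u1); rewrite mulr0 mulr0.
rewrite -subrX1 /u exprMn -!exprM ![(_ * n)%N]mulnC !exprM -rmorphXn/=.
by rewrite (prim_expr_order prw) rmorph1 !expr1n mulr1 subrr.
Qed.

(* The expectation of [z ^+ a * z^* ^+ b] for a standard complex Gaussian [z] is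
   [(a == b)%:R * a`!%:R]; averaging over roots of unity stands for the uniform
   argument of [z], and [`|z| ^+ 2] is exponential. *)
Lemma complex_gaussian_ge0 (T : finType) (c : T -> C) (a b : T -> nat) :
  (forall z : C, 0 <= \sum_t c t * (z ^+ a t * z^* ^+ b t)) ->
  0 <= \sum_t c t * ((a t == b t)%:R * (a t)`!%:R).
Proof.
move=> H.
(* [N] exceeds all exponents, so that averaging over the [N]-th roots of unity detects equality of
   [a t] and [b t], not mere congruence modulo [N]. *)
pose N := (\sum_t (a t + b t)).+1.
have [w prw] := @complex_prim_root N isT.
have aN t : (a t < N)%N.
  rewrite ltnS (bigD1 t)//=.
  exact: leq_trans (leq_addr _ _) (leq_addr _ _).
have bN t : (b t < N)%N.
  rewrite ltnS (bigD1 t)//=.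
  exact: leq_trans (leq_addl _ _) (leq_addr _ _).
have key (x : R) : 0 <= x ->
    0 <= \sum_t c t * (((a t == b t)%:R * x ^+ a t)%:C)%C.
  move=> x0; pose s := ((Num.sqrt x)%:C)%C : C.
  have ss : s * s^* = (x%:C)%C.
    by rewrite [s^*]conjc_real -rmorphM/= -expr2 sqr_sqrtr.
  have : 0 <= \sum_(j < N) \sum_t c t *
      ((s * w ^+ j) ^+ a t * (s * w ^+ j)^* ^+ b t).
    by apply: sumr_ge0 => j _.
  rewrite exchange_big/=.
  have -> : \sum_t \sum_(j < N) c t *
      ((s * w ^+ j) ^+ a t * (s * w ^+ j)^* ^+ b t) =
      N%:R * \sum_t c t * (((a t == b t)%:R * x ^+ a t)%:C)%C.
    rewrite mulr_sumr; apply: eq_bigr => t _.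
    rewrite -mulr_sumr mulrCA; congr (_ * _).
    have -> : \sum_(j < N) (s * w ^+ j) ^+ a t * (s * w ^+ j)^* ^+ b t =
        s ^+ a t * s^* ^+ b t *
        \sum_(j < N) (w ^+ j) ^+ a t * ((w ^+ j)^*) ^+ b t.
      rewrite mulr_sumr; apply: eq_bigr => j _.
      rewrite rmorphM !exprMn -!mulrA; congr (_ * _); rewrite mulrCA.
      by rewrite mulrA [_ * (w^+j)^+_]mulrC -mulrA.
    rewrite sum_prim_root//; have [<-|ab] := eqVneq (a t) (b t).
      by rewrite -exprMn ss mul1r mulr1 mulrC rmorphXn.
    by rewrite !mul0r !mulr0.
  by rewrite pmulr_rge0// ltr0n.
have {}key (x : R) : 0 <= x ->
  (0 <= \sum_t (complex.Re (c t) * (a t == b t)%:R) * x ^+ a t) /\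
  (\sum_t (complex.Im (c t) * (a t == b t)%:R) * x ^+ a t = 0).
  move=> /key; rewrite sum_complexE lecE/= => /andP[/eqP im re]; split.
    move: re; congr (_ <= _); apply: eq_bigr => t _.
    by case: (c t) => u v /=; rewrite mulr0 subr0 mulrA.
  rewrite -[RHS]im; apply: eq_bigr => t _.
  by case: (c t) => u v /=; rewrite mulr0 add0r mulrA.
have L1 : 0 <= \sum_t (complex.Re (c t) * (a t == b t)%:R) * (a t)`!%:R.
  by apply: sum_fact_ge0 => x /key[].
(* In [R[i]], [0 <= z] also requires the imaginary part to vanish; the real lemma is applied to that
   part with both signs. *)
have L2 : 0 <= \sum_t (complex.Im (c t) * (a t == b t)%:R) * (a t)`!%:R.
  by apply: sum_fact_ge0 => x /key[_ ->].
have L3 : 0 <= \sum_t (- complex.Im (c t) * (a t == b t)%:R) * (a t)`!%:R.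
  apply: sum_fact_ge0 => x /key[_ e].
  under eq_bigr do rewrite !mulNr.
  by rewrite sumrN e oppr0.
rewrite sum_complexE lecE/=.
have E t : c t * ((a t == b t)%:R * (a t)`!%:R) =
  Complex ((complex.Re (c t) * (a t == b t)%:R) * (a t)`!%:R)
   ((complex.Im (c t) * (a t == b t)%:R) * (a t)`!%:R).
  rewrite -natrM -(rmorph_nat (real_complex R)).
  by case: (c t) => u v; simpc; rewrite -!mulrA -!natrM.
apply/andP; split.
  rewrite eq_le; apply/andP; split.
    rewrite -oppr_ge0 -sumrN; move: L3; congr (_ <= _); apply: eq_bigr => t _.
    by rewrite E/= !mulNr.
  by move: L2; congr (_ <= _); apply: eq_bigr => t _; rewrite E.
by move: L1; congr (_ <= _); apply: eq_bigr => t _; rewrite E.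
Qed.

End complex_gaussian.

(** * Permanents of doubly stochastic positive semidefinite matrices *)

(** Laplace expansion of the permanent along the first row: the permutations sending [ord0] to [j]
    are the [lift_perm ord0 j s]. *)
Lemma sum_perm_prod_expand n (F : 'I_n.+1 -> 'I_n.+1 -> nat) :
  (\sum_(s : 'S_n.+1) \prod_i F i (s i) =
   \sum_j F ord0 j * \sum_(s : 'S_n) \prod_i F (lift ord0 i) (lift j (s i)))%N.
Proof.
rewrite (partition_big (fun s : 'S_n.+1 => s ord0) predT) //=.
apply: eq_bigr => j0 _; rewrite big_distrr/=.
rewrite (reindex (lift_perm ord0 j0)); last first.
  pose ulsf i (s : 'S_n.+1) k := odflt k (unlift (s i) (s (lift i k))).
  have ulsfK i (s : 'S_n.+1) k: lift (s i) (ulsf i s k) = s (lift i k).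
    rewrite /ulsf; have:= neq_lift i k.
    by rewrite -(can_eq (permK s)) => /unlift_some[] ? ? ->.
  have inj_ulsf: injective (ulsf ord0 _).
    move=> s; apply: can_inj (ulsf (s ord0) s^-1%g) _ => k'.
    by rewrite {1}/ulsf ulsfK !permK liftK.
  exists (fun s => perm (inj_ulsf s)) => [s _ | s].
    by apply/permP=> k'; rewrite permE /ulsf lift_perm_lift lift_perm_id liftK.
  move/(s _ =P _) => si0; apply/permP=> k.
  case: (unliftP ord0 k) => [k'|] ->; rewrite ?lift_perm_id //.
  by rewrite lift_perm_lift -si0 permE ulsfK.
apply: eq_big => [s|s _]; first by rewrite lift_perm_id eqxx.
rewrite big_ord_recl lift_perm_id; congr (_ * _)%N.
by apply: eq_bigr => i _; rewrite lift_perm_lift.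
Qed.

(* Both sides count the permutations [s] such that [f = g \o s]. *)
Lemma sum_perm_eq_prod_fact (K : finType) n (f g : 'I_n -> K) :
  (\sum_(s : 'S_n) \prod_i (f i == g (s i)) =
   \prod_(k : K) ((\sum_i (f i == k) == \sum_i (g i == k)) *
                  (\sum_i (f i == k))`!))%N.
Proof.
elim: n f g => [|n IH] f g.
  rewrite [RHS]big1 => [|k _]; last by rewrite !big_ord0 eqxx.
  rewrite (eq_bigr (fun=> 1%N)) => [|s _]; last by rewrite big_ord0.
  by rewrite sum1_card card_Sn.
rewrite (sum_perm_prod_expand (fun i j => (f i == g j) : nat)).
pose cf k := (\sum_i (f i == k))%N; pose cg k := (\sum_i (g i == k))%N.
pose k0 := f ord0.
pose cf' := (\sum_(i < n) (f (lift ord0 i) == k0))%N.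
have cf0 : cf k0 = cf'.+1 by rewrite /cf big_ord_recl eqxx.
(* Only the columns [j] with [g j = k0] contribute, all equally. Their number [cg k0], equal to
   [cf k0] when the term survives, completes the factorial of [cf' + 1]. *)
transitivity (\sum_j (k0 == g j) * ((cf k0 == cg k0) * cf'`! *
    \prod_(k | k != k0) ((cf k == cg k) * (cf k)`!)))%N.
  apply: eq_bigr => j _; rewrite -/k0; have [k0j|_] := eqVneq k0 (g j); last first.
    by rewrite !mul0n.
  rewrite !mul1n (IH (f \o lift ord0) (g \o lift j)) (bigD1 k0)//=.
  have cgE k : cg k = ((k0 == k) + \sum_i (g (lift j i) == k))%N.
    by rewrite /cg (bigD1_ord j)//= -k0j.
  congr (_ * _ * _)%N; first by rewrite cf0 cgE eqxx eqSS.
  apply: eq_bigr => k kk0.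
  by rewrite cgE /cf big_ord_recl -/k0 [k0 == k]eq_sym (negbTE kk0).
rewrite -big_distrl/= [RHS](bigD1 k0)//= -/(cf k0) -/(cg k0) mulnA.
congr (_ * _)%N.
rewrite (eq_bigr (fun j => (g j == k0) : nat)) => [|j _]; last by rewrite eq_sym.
rewrite -/(cg k0) mulnCA; have [e|] := eqVneq (cf k0) (cg k0); last by rewrite !mul0n.
by rewrite -e cf0 factS !mul1n.
Qed.

(** * Truncated exponential and geometric series *)

Section truncated_exponential.
Context {F : numFieldType}.
Implicit Types x y : F.

(** Integrating a standard complex Gaussian [z] out of [(|z|^2 + y)^n] leaves [n]! times this
    function of [y]; its submultiplicativity then separates the remaining variables. *)
Definition trunc_exp n x : F := \sum_(l < n.+1) x ^+ l / l`!%:R.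

Lemma trunc_exp_ge0 n x : 0 <= x -> 0 <= trunc_exp n x.
Proof. by move=> x0; apply: sumr_ge0 => l _; rewrite divr_ge0// exprn_ge0. Qed.

Lemma trunc_exp0 n : trunc_exp n 0 = 1.
Proof.
rewrite /trunc_exp big_ord_recl expr0 fact0 divr1 big1 ?addr0// => l _.
by rewrite expr0n mul0r.
Qed.

Lemma exprD_fact n x y :
  (x + y) ^+ n / n`!%:R =
  \sum_(i < n.+1) (x ^+ (n - i) / (n - i)`!%:R) * (y ^+ i / i`!%:R).
Proof.
rewrite exprDn mulr_suml; apply: eq_bigr => i _.
have ile : (i <= n)%N by rewrite -ltnS.
rewrite -mulr_natr -(bin_fact ile) !natrM.
field.
rewrite !pnatr_eq0 -!lt0n !fact_gt0/= bin_gt0 ile//.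
Qed.

(** With [u] and [v] the terms of the two series, the left side collects the products [u p * v i]
    with [p + i <= n], the right side all those with [p <= n] and [i <= n]. *)
Lemma trunc_expD n x y : 0 <= x -> 0 <= y ->
  trunc_exp n (x + y) <= trunc_exp n x * trunc_exp n y.
Proof.
move=> x0 y0.
pose u p := x ^+ p / p`!%:R; pose v i := y ^+ i / i`!%:R.
have u0 p : 0 <= u p by rewrite divr_ge0// exprn_ge0.
have v0 p : 0 <= v p by rewrite divr_ge0// exprn_ge0.
have -> : trunc_exp n (x + y) =
    \sum_(i < n.+1) \sum_(l < n.+1 | (i <= l)%N) u (l - i)%N * v i.
  rewrite /trunc_exp; under eq_bigr => l _.
    rewrite exprD_fact -/(u _) -/(v _).
    rewrite (big_ord_widen n.+1 (fun i => u (l - i)%N * v i)) ?ltn_ord//; over.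
  by rewrite (exchange_big_dep xpredT).
rewrite /trunc_exp mulr_sumr; apply: ler_sum => i _.
rewrite -mulr_suml ler_wpM2r//.
rewrite -(big_geq_mkord i n.+1 xpredT (fun l => u (l - i)%N)).
rewrite -(big_mkord xpredT u) -{1}[i : nat]add0n big_addn.
under eq_bigr do rewrite addnK.
rewrite [leRHS](big_cat_nat (leq0n (n.+1 - i)) (leq_subr i n.+1))/=.
by rewrite lerDl sumr_ge0.
Qed.

Lemma geometric_sum_le n x : 0 <= x -> x < 1 ->
  \sum_(i < n) x ^+ i <= (1 - x)^-1.
Proof.
move=> x0 x1; have x10 : 0 < 1 - x by rewrite subr_gt0.
rewrite -[leRHS]mul1r ler_pdivlMr// mulrC -opprB mulNr -subrX1 opprB.
by rewrite lerBlDr lerDl exprn_ge0.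
Qed.

End truncated_exponential.

(** * Integrating out Gaussian variables one at a time *)

Section gaussian_elimination.
Context {R : realType}.
Local Notation C := R[i].
Variables (T : finType) (c : T -> C) (a b : T -> nat -> nat).
Implicit Types z : nat -> C.

(* The variables of index less than [j] have been integrated out against
   independent standard complex Gaussians. *)
Definition wick_factor j t z k : C :=
  if (k < j)%N then (a t k == b t k)%:R * (a t k)`!%:R
  else z k ^+ a t k * (z k)^* ^+ b t k.

Let W m j z : C := \sum_t c t * \prod_(k < m) wick_factor j t z k.

Definition set_var z j w : nat -> C := fun k => if k == j then w else z k.

(** With the other variables frozen, the difference of the two sides is a nonnegative polynomial in
    [z j] and its conjugate, whose terms are indexed by [T + 'I_n]; its Gaussian expectation is
    nonnegative. The coefficients [d] must not involve [z j]. *)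
Lemma gaussian_elimination_step m j n (d : 'I_n -> (nat -> C) -> C) :
  (j < m)%N ->
  (forall l z w, d l (set_var z j w) = d l z) ->
  (forall z, W m j z <= \sum_l d l z * (z j * (z j)^*) ^+ l) ->
  forall z, W m j.+1 z <= \sum_l d l z * l`!%:R.
Proof.
move=> jm dupd H z.
pose P t := \prod_(k < m | (k : nat) != j) wick_factor j t z k.
pose c' (u : T + 'I_n) := match u with inl t => - (c t * P t) | inr l => d l z end.
pose a' (u : T + 'I_n) := match u with inl t => a t j | inr l => l : nat end.
pose b' (u : T + 'I_n) := match u with inl t => b t j | inr l => l : nat end.
have := @complex_gaussian_ge0 R _ c' a' b'.
rewrite big_sumType/=.
have -> : \sum_t - (c t * P t) * ((a t j == b t j)%:R * (a t j)`!%:R) =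
   - W m j.+1 z.
  rewrite /W -sumrN; apply: eq_bigr => t _.
  rewrite mulNr -mulrA; congr (- (_ * _)).
  rewrite [RHS](bigD1 (Ordinal jm))//= mulrC.
  rewrite [wick_factor _ _ _ j]/wick_factor ltnS leqnn; congr (_ * _).
  apply: eq_big => [k|k kj]; first by rewrite -val_eqE.
  by rewrite /wick_factor ltnS [(k <= j)%N]leq_eqVlt (negbTE kj).
under [X in _ -> 0 <= _ + X]eq_bigr do rewrite eqxx mul1r.
move=> /(_ _); rewrite addrC subr_ge0; apply => w.
rewrite big_sumType/= addrC.
have := H (set_var z j w); rewrite -subr_ge0; congr (_ <= _ + _).
  by apply: eq_bigr => l _; rewrite dupd /set_var eqxx exprMn.
rewrite -sumrN; apply: eq_bigr => t _.
rewrite mulNr -mulrA; congr (- (_ * _)).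
rewrite (bigD1 (Ordinal jm))//= mulrC.
rewrite [wick_factor _ _ _ j]/wick_factor ltnn /set_var eqxx; congr (_ * _).
apply: eq_big => [k|k kj]; first by rewrite -val_eqE.
by rewrite /wick_factor -val_eqE/= in kj *; rewrite (negbTE kj).
Qed.

(** The variable [z 0], of weight 1, is integrated first and exactly, since its geometric series
    would diverge. Each further variable is split off by [trunc_expD] and contributes a geometric
    sum in [lam k]. *)
Lemma gaussian_elimination m n (lam : nat -> C) :
  (forall k, 0 <= lam k) -> (forall k, lam k < 1) ->
  (forall z, \sum_t c t * \prod_(k < m.+1) (z k ^+ a t k * (z k)^* ^+ b t k) <=
     (z 0%N * (z 0%N)^* + \sum_(k < m) lam k * (z k.+1 * (z k.+1)^*)) ^+ n) ->
  \sum_t c t * \prod_(k < m.+1) ((a t k == b t k)%:R * (a t k)`!%:R) <=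
  n`!%:R * \prod_(k < m) (1 - lam k)^-1.
Proof.
move=> l0 l1 H.
pose y j z := \sum_(j <= k < m) lam k * (z k.+1 * (z k.+1)^*).
have y0 j z : 0 <= y j z.
  by apply: sumr_ge0 => k _; rewrite mulr_ge0// mul_conjC_ge0.
have yupd j i z w : (i <= j)%N -> y j (set_var z i w) = y j z.
  move=> ij; apply: eq_big_nat => k /andP[jk _]; rewrite /set_var gtn_eqF//.
  by rewrite ltnS (leq_trans ij).
have l10 k : 0 <= (1 - lam k)^-1 by rewrite invr_ge0 subr_ge0 ltW.
have claim j : (j <= m)%N -> forall z, W m.+1 j.+1 z <=
    n`!%:R * \prod_(k < j) (1 - lam k)^-1 * trunc_exp n (y j z).
  elim: j => [_ z|j IH jm z].
    pose d (l : 'I_n.+1) z := y 0%N z ^+ (n - l) *+ 'C(n, l).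
    have := @gaussian_elimination_step m.+1 0 n.+1 d isT.
    move=> /(_ _ _ z); have -> : \sum_l d l z * l`!%:R =
        n`!%:R * \prod_(k < 0) (1 - lam k)^-1 * trunc_exp n (y 0%N z).
      rewrite big_ord0 mulr1 (reindex_inj rev_ord_inj)/= mulr_sumr.
      apply: eq_bigr => l _; have ln : (l <= n)%N by rewrite -ltnS.
      rewrite /d/= subSS subKn// bin_sub// -mulr_natr -(bin_fact ln) !natrM.
      by field; rewrite pnatr_eq0 -lt0n fact_gt0.
    apply=> [l z' w|z']; first by rewrite /d yupd.
    apply: (le_trans (H z')); rewrite addrC.
    have <- : y 0%N z' = \sum_(k < m) lam k * (z' k.+1 * (z' k.+1)^*).
      by rewrite /y big_mkord.
    rewrite exprDn le_eqVlt; apply/orP; left; apply/eqP.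
    by apply: eq_bigr => l _; rewrite /d mulrnAl.
  have [K eK] : exists K, K = n`!%:R * \prod_(k < j) (1 - lam k)^-1 by eexists.
  have K0 : 0 <= K by rewrite eK mulr_ge0// prodr_ge0.
  pose d (l : 'I_n.+1) z := K * trunc_exp n (y j.+1 z) * (lam j ^+ l / l`!%:R).
  have := @gaussian_elimination_step m.+1 j.+1 n.+1 d.
  move=> /(_ _ _ _ z) step; apply: le_trans.
    apply: step => // [l z' w|z']; first by rewrite /d yupd.
    apply: (le_trans (IH (ltnW jm) z')).
    rewrite -eK /d; under eq_bigr do rewrite -!mulrA.
    rewrite -mulr_sumr ler_wpM2l// -mulr_sumr.
    rewrite {1}/y big_ltn// addrC; apply: le_trans (trunc_expD _ (y0 j.+1 z') _) _.
      by rewrite mulr_ge0// mul_conjC_ge0.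
    rewrite le_eqVlt; apply/orP; left; apply/eqP; congr (_ * _).
    by apply: eq_bigr => l _; rewrite exprMn mulrAC mulrA.
  have dE (l : 'I_n.+1) :
      d l z * l`!%:R = K * trunc_exp n (y j.+1 z) * lam j ^+ l.
    rewrite /d; field; by rewrite pnatr_eq0 -lt0n fact_gt0.
  under eq_bigr do rewrite dE.
  rewrite -mulr_sumr [in leRHS]big_ord_recr/= [n`!%:R * _]mulrA -eK -!mulrA ler_wpM2l//.
  by rewrite mulrC ler_wpM2r ?trunc_exp_ge0// geometric_sum_le.
have := claim m (leqnn m) (fun=> 0); rewrite /y big_geq// trunc_exp0 mulr1.
congr (_ <= _); apply: eq_bigr => t _; congr (_ * _); apply: eq_bigr => k _.
by rewrite /wick_factor ltn_ord.
Qed.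

End gaussian_elimination.

(** * Wick's formula and the permanent bound *)

Section permanent.
Context {R : realType}.
Local Notation C := R[i].

Lemma prodr_count_exp (I K : finType) (f : I -> K) (z : K -> C) :
  \prod_i z (f i) = \prod_k z k ^+ (\sum_i (f i == k))%N.
Proof.
rewrite (partition_big f predT)//=; apply: eq_bigr => k _.
rewrite (eq_bigr (fun=> z k)) => [|i /eqP->//].
by rewrite prodr_const -sum1_card big_mkcond/=; congr (_ ^+ _).
Qed.

(** A monomial is given by two choice functions, one for the factors and one for their conjugates;
    the sizes of their fibres are the exponents. *)
Lemma expand_prod_sum_sqr n m (V : 'I_n -> 'I_m -> C) (z : 'I_m -> C) :
  \prod_(i < n) ((\sum_k V i k * z k) * (\sum_k V i k * z k)^*) =
  \sum_(u : {ffun 'I_n -> 'I_m} * {ffun 'I_n -> 'I_m})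
    (\prod_i (V i (u.1 i) * (V i (u.2 i))^*)) *
    \prod_k (z k ^+ (\sum_i (u.1 i == k))%N * (z k)^* ^+ (\sum_i (u.2 i == k))%N).
Proof.
rewrite big_split/=.
under [X in _ * X]eq_bigr do rewrite rmorph_sum/=.
rewrite !bigA_distr_bigA/= big_distrlr/= pair_big/=.
apply: eq_bigr => -[f g] _ /=.
rewrite !big_split/= -!prodr_count_exp.
under [X in _ * X = _]eq_bigr do rewrite rmorphM/=.
rewrite (prodr_count_exp g (fun k => (z k)^*)) -(prodr_count_exp g).
by rewrite !big_split/= mulrACA.
Qed.

(** Wick's formula: the Gaussian moment of a monomial counts the permutations matching [u.1] with
    [u.2], and for a fixed permutation the sum over [u] factorizes. *)
Lemma sum_ffun_perm n m (V : 'I_n -> 'I_m -> C) :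
  \sum_(u : {ffun 'I_n -> 'I_m} * {ffun 'I_n -> 'I_m})
    (\prod_i (V i (u.1 i) * (V i (u.2 i))^*)) *
    \prod_k (((\sum_i (u.1 i == k))%N == (\sum_i (u.2 i == k))%N)%:R *
             ((\sum_i (u.1 i == k))%N)`!%:R) =
  \sum_(s : 'S_n) \prod_i \sum_k V i k * (V (s i) k)^*.
Proof.
transitivity (\sum_(u : {ffun 'I_n -> 'I_m} * {ffun 'I_n -> 'I_m})
    \sum_(s : 'S_n) (\prod_i (V i (u.1 i) * (V i (u.2 i))^*)) *
    \prod_i (u.1 i == u.2 (s i))%:R).
  apply: eq_bigr => -[f g] _ /=; rewrite -mulr_sumr; congr (_ * _).
  under eq_bigr do rewrite -natrM.
  rewrite -natr_prod -sum_perm_eq_prod_fact natr_sum.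
  by apply: eq_bigr => s _; rewrite natr_prod.
rewrite exchange_big/=; apply: eq_bigr => s _.
rewrite bigA_distr_bigA/=.
rewrite -(pair_big predT predT (fun f g : {ffun 'I_n -> 'I_m} =>
  (\prod_i (V i (f i) * (V i (g i))^*)) * \prod_i (f i == g (s i))%:R))/=.
apply: eq_bigr => f _.
rewrite big_split/=.
under eq_bigr => g _.
  rewrite big_split/= [X in _ * X * _](reindex_inj (@perm_inj _ s))/=.
  rewrite -mulrA -big_split/=; over.
rewrite -mulr_sumr; congr (_ * _).
rewrite (reindex (fun h : {ffun 'I_n -> 'I_m} => [ffun i => h (s^-1%g i)]))/=; last first.
  exists (fun h : {ffun 'I_n -> 'I_m} => [ffun i => h (s i)]) => h _;
    by apply/ffunP => i; rewrite !ffunE ?permK ?permKV.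
under eq_bigr do under eq_bigr do rewrite ffunE permK.
rewrite -(bigA_distr_bigA (fun i k => (V (s i) k)^* * (f i == k)%:R)).
apply: eq_bigr => i _; rewrite (bigD1 (f i))//= eqxx mulr1 big1 ?addr0// => k.
by rewrite eq_sym => /negbTE ->; rewrite mulr0.
Qed.

(* By Wick's formula the permanent is the expectation of the product of the
   [`|Z i| ^+ 2] for [Z i = \sum_k V i k * z k], with [z] standard Gaussian;
   AM-GM bounds that product by a power of
   [\sum_i `|Z i| ^+ 2 = `|z 0| ^+ 2 + \sum_k d k * `|z k.+1| ^+ 2]. *)
Lemma permanent_le n (P : 'M[C]_n.+1) (d : 'I_n.+1 -> C) :
  P \is unitarymx -> (forall k, 0 <= d k) -> (forall k, d k < 1) ->
  (forall k, d k * \sum_i P k i = 0) ->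
  n.+1%:R ^+ n.+1 * \sum_(s : 'S_n.+1) \prod_i
    (n.+1%:R^-1 + \sum_k (P k i)^* * d k * P k (s i)) <=
  n.+1`!%:R * \prod_k (1 - d k)^-1.
Proof.
set N := n.+1 => Pu d0 d1 dP.
(* [V] is a square root of the matrix in the statement: a constant column for the part [1/N], then
   the eigenvectors scaled by the square roots of the [d k]. *)
pose V (i : 'I_N) (k : 'I_N.+1) : C :=
  if unlift ord0 k is Some k' then (P k' i)^* * sqrtC (d k') else sqrtC N%:R^-1.
have V0 i : V i ord0 = sqrtC N%:R^-1 by rewrite /V unlift_none.
have VS i k : V i (lift ord0 k) = (P k i)^* * sqrtC (d k) by rewrite /V liftK.
have sqrtK (x : C) : 0 <= x -> sqrtC x * (sqrtC x)^* = x.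
  by move=> x0; rewrite conj_Creal ?ger0_real ?sqrtC_ge0// -expr2 sqrtCK.
have N0 : 0 <= N%:R^-1 :> C by rewrite invr_ge0 ler0n.
have N0' : N%:R != 0 :> C by rewrite pnatr_eq0.
have PP k l : \sum_i P k i * (P l i)^* = (k == l)%:R.
  move/unitarymxP: Pu => /matrixP/(_ k l); rewrite !mxE => <-.
  by apply: eq_bigr => i _; rewrite !mxE.
pose lam (k : nat) : C := if insub k is Some k' then d k' else 0.
have lamE (k : 'I_N) : lam k = d k by rewrite /lam valK.
pose a (f : {ffun 'I_N -> 'I_N.+1}) (k : nat) := (\sum_i ((f i : nat) == k))%N.
pose c (u : {ffun 'I_N -> 'I_N.+1} * {ffun 'I_N -> 'I_N.+1}) : C :=
  N%:R ^+ N * \prod_i (V i (u.1 i) * (V i (u.2 i))^*).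
have := @gaussian_elimination R _ c (fun u => a u.1) (fun u => a u.2) N N lam.
have -> : \prod_(k < N) (1 - lam k)^-1 = \prod_k (1 - d k)^-1.
  by apply: eq_bigr => k _; rewrite lamE.
have -> : \sum_(s : 'S_N) \prod_i
    (N%:R^-1 + \sum_k (P k i)^* * d k * P k (s i)) =
    \sum_(s : 'S_N) \prod_i \sum_k V i k * (V (s i) k)^*.
  apply: eq_bigr => s _; apply: eq_bigr => i _.
  rewrite [RHS]big_ord_recl !V0 sqrtK//; congr (_ + _); apply: eq_bigr => k _.
  rewrite !VS rmorphM/= conjCK mulrACA sqrtK//; ring.
move=> elimination; rewrite -sum_ffun_perm mulr_sumr.
apply: le_trans (elimination _ _ _).
- rewrite le_eqVlt; apply/orP; left; apply/eqP; apply: eq_bigr => u _.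
  by rewrite /c -[RHS]mulrA.
- by move=> k; rewrite /lam; case: insub.
- by move=> k; rewrite /lam; case: insub => //; exact: ltr01.
move=> z; pose Z i := \sum_k V i k * z (nat_of_ord k).
have -> : \sum_t c t * \prod_(k < N.+1) (z k ^+ a t.1 k * (z k)^* ^+ a t.2 k) =
    N%:R ^+ N * \prod_i (Z i * (Z i)^*).
  rewrite /Z (expand_prod_sum_sqr V (fun k => z k)) mulr_sumr.
  by apply: eq_bigr => u _; rewrite mulrA.
have -> : z 0%N * (z 0%N)^* + \sum_(k < N) lam k * (z k.+1 * (z k.+1)^*) =
    \sum_i Z i * (Z i)^*.
  pose w (k : 'I_N) := z k.+1.
  pose Wd i := \sum_k (P k i)^* * sqrtC (d k) * w k.
  have ZE i : Z i = sqrtC N%:R^-1 * z 0%N + Wd i.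
    by rewrite /Z big_ord_recl V0; congr (_ + _); apply: eq_bigr => k _; rewrite VS.
  (* By [dP], a row of [P] with [d k != 0] is orthogonal to the constants; this removes the cross
     terms between [z 0] and the other variables. *)
  have Wd0 : \sum_i (Wd i)^* = 0.
    rewrite /Wd; under eq_bigr do rewrite rmorph_sum/=.
    rewrite exchange_big/= big1// => k _.
    under eq_bigr do rewrite !rmorphM/= conjCK -mulrA.
    rewrite -mulr_suml; have [dk|dk] := eqVneq (d k) 0.
      by rewrite dk sqrtC0 rmorph0 mul0r mulr0.
    by have /eqP := dP k; rewrite mulf_eq0 (negbTE dk)/= => /eqP ->; rewrite mul0r.
  have Wd0' : \sum_i Wd i = 0.
    by apply: (can_inj (@conjCK _)); rewrite rmorph_sum Wd0 rmorph0.
  have -> : \sum_i Z i * (Z i)^* =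
      \sum_i ((N%:R^-1 * (z 0%N * (z 0%N)^*) + Wd i * (Wd i)^*) +
      ((sqrtC N%:R^-1 * z 0%N) * (Wd i)^* + Wd i * (sqrtC N%:R^-1 * z 0%N)^*)).
    apply: eq_bigr => i _; rewrite ZE rmorphD/= -[X in X * (z 0%N * _)](sqrtK N%:R^-1)//.
    rewrite rmorphM/=; ring.
  have c1 : \sum_i (sqrtC N%:R^-1 * z 0%N) * (Wd i)^* = 0.
    by rewrite -mulr_sumr Wd0 mulr0.
  have c2 : \sum_i Wd i * (sqrtC N%:R^-1 * z 0%N)^* = 0.
    by rewrite -mulr_suml Wd0' mul0r.
  rewrite !big_split/= c1 c2 !addr0.
  rewrite sumr_const card_ord -[_ *+ _]mulr_natl mulrA mulfV// mul1r; congr (_ + _).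
  rewrite /Wd; under [RHS]eq_bigr do rewrite rmorph_sum big_distrlr/=.
  rewrite exchange_big/=; apply: eq_bigr => k _.
  rewrite exchange_big/= (bigD1 k)//= [X in _ = _ + X]big1 ?addr0 => [|l lk].
    rewrite lamE -/(w k) -[d k in LHS]sqrtK//.
    transitivity (sqrtC (d k) * (sqrtC (d k))^* * (w k * (w k)^*) *
      \sum_i P k i * (P k i)^*); first by rewrite PP eqxx mulr1.
    by rewrite mulr_sumr; apply: eq_bigr => i _; rewrite !rmorphM/= conjCK; ring.
  transitivity (sqrtC (d k) * (sqrtC (d l))^* * (w k * (w l)^*) *
    \sum_i P l i * (P k i)^*); last by rewrite PP (negbTE lk) mulr0.
  by rewrite mulr_sumr; apply: eq_bigr => i _; rewrite !rmorphM/= conjCK; ring.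
have := @leif_AGM _ _ (mem 'I_N) (fun i => Z i * (Z i)^*).
rewrite card_ord => /(_ _)[i _|]; first exact: mul_conjC_ge0.
move=> agm _; rewrite expr_div_n in agm.
rewrite mulrC -ler_pdivlMr//.
by rewrite exprn_gt0// ltr0n.
Qed.

End permanent.

(** * Permanent of a rank-one average plus a positive semidefinite perturbation *)

Section real_spectral.
Context {R : realType}.
Variable n : nat.
Local Notation N := n.+1.
Local Notation C := R[i].
Variable B : 'I_N -> 'I_N -> R.
Hypothesis Bsym : forall i j, B i j = B j i.
Hypothesis Brow : forall i, \sum_j B i j = 0.
Hypothesis Bpsd : forall x : 'I_N -> R, 0 <= \sum_i \sum_j x i * B i j * x j.

Lemma Re_sum (I : finType) (w : I -> C) :
  complex.Re (\sum_i w i) = \sum_i complex.Re (w i).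
Proof. by rewrite sum_complexE. Qed.

Let toC (x : R) : C := (x%:C)%C.

(** The complex spectral theorem for the real symmetric [B], the rows of [P] being eigenvectors. The
    last clause turns a bound on the quadratic form into a bound on the eigenvalues. *)
Lemma spectral_decomposition : exists (P : 'M[C]_N) (lam : 'I_N -> R),
  [/\ P \is unitarymx,
      forall i j, toC (B i j) = \sum_k (P k i)^* * toC (lam k) * P k j,
      forall k j, \sum_i P k i * toC (B i j) = toC (lam k) * P k j,
      forall k, 0 <= lam k &
      forall c, (forall x : 'I_N -> R,
        \sum_i \sum_j x i * B i j * x j <= c * \sum_i x i ^+ 2) ->
        forall k, lam k <= c].
Proof.
pose A : 'M[C]_N := \matrix_(i, j) toC (B i j).
have Aherm : A \is hermsymmx.
  rewrite qualifE/= expr0 scale1r; apply/eqP/matrixP => i j; rewrite !mxE.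
  by rewrite Bsym; apply/esym/conjc_real.
have Anorm := hermitian_normalmx Aherm.
pose P := spectralmx A; pose D := spectral_diag A.
have Pu : P \is unitarymx by exact: spectral_unitarymx.
have AE : A = invmx P *m diag_mx D *m P by apply/orthomx_spectralP.
have Dreal k : D 0 k = toC (complex.Re (D 0 k)).
  have /mxOverP/(_ 0 k) := hermitian_spectral_diag_real Aherm.
  by move=> /RRe_real <-.
pose lam k := complex.Re (D 0 k).
have BE i j : toC (B i j) = \sum_k (P k i)^* * toC (lam k) * P k j.
  have -> : toC (B i j) = A i j by rewrite mxE.
  rewrite AE invmx_unitary// mxE; apply: eq_bigr => k _.
  by rewrite mul_mx_diag !mxE -Dreal.
have PB k j : \sum_i P k i * toC (B i j) = toC (lam k) * P k j.
  have : P *m A = diag_mx D *m P.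
    by rewrite AE !mulmxA mulmxV ?mul1mx// unitarymx_unit.
  move=> /matrixP/(_ k j); rewrite mul_diag_mx !mxE -Dreal => <-.
  by apply: eq_bigr => i _; rewrite mxE.
have PP k l : \sum_i P k i * (P l i)^* = (k == l)%:R.
  move/unitarymxP: Pu => /matrixP/(_ k l); rewrite !mxE => <-.
  by apply: eq_bigr => i _; rewrite !mxE.
pose re k i := complex.Re (P k i); pose im k i := complex.Im (P k i).
have norm1 k : \sum_i re k i ^+ 2 + \sum_i im k i ^+ 2 = 1.
  have := congr1 (@complex.Re R) (PP k k); rewrite eqxx Re_sum/= => <-.
  rewrite -big_split/=; apply: eq_bigr => i _; rewrite /re /im.
  by case: (P k i) => u v /=; rewrite mulrN opprK !expr2.
(* The quadratic form is controlled on real vectors only, so the Rayleigh quotient is split over the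
   real and imaginary parts, whose squared norms add up to 1. *)
have lamE k : lam k = \sum_i \sum_j re k i * B i j * re k j +
                      \sum_i \sum_j im k i * B i j * im k j.
  have : toC (lam k) = \sum_i \sum_j P k i * toC (B i j) * (P k j)^*.
    rewrite exchange_big/=.
    under eq_bigr do rewrite -mulr_suml PB -mulrA.
    by rewrite -mulr_sumr PP eqxx mulr1.
  move=> /(congr1 (@complex.Re R)); rewrite /= => ->.
  rewrite Re_sum -big_split/=; apply: eq_bigr => i _.
  rewrite Re_sum -big_split/=; apply: eq_bigr => j _; rewrite /re /im /toC.
  case: (P k i) => u v; case: (P k j) => u' v' /=; ring.
have lam0 k : 0 <= lam k by rewrite lamE addr_ge0.
exists P, lam; split => // c Hc k; rewrite lamE -[c]mulr1 -(norm1 k) mulrDr.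
by apply: lerD; exact: Hc.
Qed.

(** The function [F(t)] of the overview. *)
Definition scaled_perm (t : R) : R :=
  N%:R ^+ N / N`!%:R * \sum_(s : 'S_N) \prod_i (N%:R^-1 + t * B i (s i)).

Lemma scaled_perm_le : exists lam : 'I_N -> R,
  [/\ forall k, 0 <= lam k,
      \sum_k lam k = \sum_i B i i,
      forall c, (forall x : 'I_N -> R,
        \sum_i \sum_j x i * B i j * x j <= c * \sum_i x i ^+ 2) ->
        forall k, lam k <= c &
      forall t, 0 <= t -> (forall k, t * lam k < 1) ->
        scaled_perm t <= \prod_k (1 - t * lam k)^-1].
Proof.
have [P [lam [Pu BE PB lam0 lamc]]] := spectral_decomposition.
have PP k l : \sum_i P k i * (P l i)^* = (k == l)%:R.
  move/unitarymxP: Pu => /matrixP/(_ k l); rewrite !mxE => <-.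
  by apply: eq_bigr => i _; rewrite !mxE.
exists lam; split => //.
- apply: (@complexI R); rewrite !rmorph_sum/=.
  under [RHS]eq_bigr do rewrite -/(toC _) BE.
  rewrite exchange_big/=; apply: eq_bigr => k _.
  rewrite -[LHS]mulr1 -[1](_ : \sum_i P k i * (P k i)^* = _); last first.
    by rewrite PP eqxx.
  by rewrite mulr_sumr; apply: eq_bigr => i _; rewrite /toC; ring.
move=> t t0 tlam.
rewrite -lecR /scaled_perm.
have := @permanent_le R n P (fun k => toC (t * lam k)) Pu.
have h0 k : 0 <= toC (t * lam k) by rewrite ler0c mulr_ge0.
have h1 k : toC (t * lam k) < 1 by rewrite -(rmorph1 (real_complex R)) ltcR.
(* Up to the factor [t], the left side is entry [k] of [P *m B] applied to the constant vector,
   which vanishes with the row sums of [B]. *)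
have h2 k : toC (t * lam k) * \sum_i P k i = 0.
  rewrite /toC rmorphM/= -mulrA mulr_sumr.
  under eq_bigr do rewrite -/(toC _) -PB.
  rewrite exchange_big/= big1 ?mulr0// => i _.
  by rewrite -mulr_sumr -rmorph_sum/= Brow rmorph0 mulr0.
move=> /(_ h0 h1 h2).
rewrite rmorphM rmorphM fmorphV rmorphXn !rmorph_nat/= mulrAC.
rewrite ler_pdivrMr ?ltr0n ?fact_gt0// [X in _ -> _ <= X]mulrC.
congr (_ * _ <= _ * _).
  rewrite rmorph_sum; apply: eq_bigr => s _; rewrite rmorph_prod.
  apply: eq_bigr => i _; rewrite rmorphD/= fmorphV rmorph_nat; congr (_ + _).
  rewrite rmorphM/= -/(toC _) -/(toC _) BE mulr_sumr; apply: eq_bigr => k _.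
  rewrite /toC rmorphM/=; ring.
rewrite rmorph_prod; apply: eq_bigr => k _.
by rewrite fmorphV rmorphB rmorph1.
Qed.

(** Contribution of [S] to the coefficient of degree [#|S|] of [scaled_perm]. Rows and columns are
    both permuted, so that it can be written as a sum of squared moduli. *)
Definition perm_coef (S : {set 'I_N}) : R :=
  N%:R ^+ #|S| / N`!%:R ^+ 2 *
  \sum_(s : 'S_N) \sum_(p : 'S_N) \prod_(i in S) B (s i) (p i).

(** Relabelling the factors by [s] does not change the inner sum, so a second permutation can be
    averaged over before expanding the product over subsets. *)
Lemma scaled_perm_expand t :
  scaled_perm t = \sum_(S : {set 'I_N}) t ^+ #|S| * perm_coef S.
Proof.
have N0 : N%:R != 0 :> R by rewrite pnatr_eq0.
have F0 : N`!%:R != 0 :> R by rewrite pnatr_eq0 -lt0n fact_gt0.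
pose G (s p : 'S_N) := \prod_i (N%:R^-1 + t * B (s i) (p i)).
have GE s : \sum_p G s p = \sum_(p : 'S_N) \prod_i (N%:R^-1 + t * B i (p i)).
  rewrite (reindex_inj (mulgI s))/=; apply: eq_bigr => p _.
  rewrite /G [RHS](reindex_inj (@perm_inj _ s))/=.
  by apply: eq_bigr => i _; rewrite permM.
have -> : scaled_perm t = N%:R ^+ N / N`!%:R ^+ 2 * \sum_s \sum_p G s p.
  under eq_bigr do rewrite GE.
  rewrite sumr_const card_Sn -[X in _ = _ * X]mulr_natr /scaled_perm.
  move: (\sum_(s : 'S_N) _) (N`!%:R) (N%:R ^+ N) F0 => X F K F0.
  by field.
have GE2 s p : G s p = \sum_(S : {set 'I_N})
    t ^+ #|S| * (N%:R^-1 ^+ (N - #|S|) * \prod_(i in S) B (s i) (p i)).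
  rewrite /G; under eq_bigr do rewrite addrC.
  rewrite bigA_distr/=; apply: eq_bigr => S _.
  rewrite (bigID (mem S))/=.
  rewrite (eq_bigr (fun i => t * B (s i) (p i))) => [|i ->//].
  rewrite big_split/= prodr_const [X in _ * X](eq_bigr (fun=> N%:R^-1)); last first.
    by move=> i /negbTE ->.
  rewrite prodr_const -mulrA; congr (_ * _); rewrite mulrC; congr (_ ^+ _ * _).
  have := cardC (mem S); rewrite card_ord => E.
  by rewrite -[X in (X - _)%N]E addKn.
under eq_bigr do under eq_bigr do rewrite GE2.
under eq_bigr do rewrite exchange_big/=.
rewrite exchange_big/= mulr_sumr; apply: eq_bigr => S _.
rewrite /perm_coef.
under eq_bigr do rewrite -mulr_sumr -mulr_sumr.
rewrite -mulr_sumr -mulr_sumr.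
have SN : (#|S| <= N)%N by rewrite -[N in (_ <= N)%N]card_ord max_card.
rewrite -[X in N%:R ^+ X / _](subnKC SN) exprD exprVn.
have := expf_neq0 (N - #|S|) N0.
move: (\sum_(s : 'S_N) _) (N`!%:R) F0 (N%:R ^+ (N - #|S|)) => X F F0 K K0.
by field; rewrite F0 K0.
Qed.

(** Factor [B] through [V] and its adjoint: for each choice [f] of inner indices, the two sums over
    permutations are conjugate to each other. *)
Lemma perm_coef_ge0 S : 0 <= perm_coef S.
Proof.
have [P [lam [Pu BE PB lam0 _]]] := spectral_decomposition.
pose V i k := (P k i)^* * sqrtC (toC (lam k)).
have BV i j : toC (B i j) = \sum_k V i k * (V j k)^*.
  rewrite BE; apply: eq_bigr => k _; rewrite /V rmorphM/= conjCK.
  have l0 : 0 <= toC (lam k) by rewrite ler0c.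
  rewrite [(sqrtC _)^*]conj_Creal ?ger0_real ?sqrtC_ge0// -[in LHS](sqrtCK (toC _)).
  by rewrite expr2; ring.
rewrite /perm_coef mulr_ge0// ?divr_ge0 ?exprn_ge0//.
suff : 0 <= toC (\sum_(s : 'S_N) \sum_(p : 'S_N) \prod_(i in S) B (s i) (p i)).
  by rewrite ler0c.
(* Outside [S] the inner index is pinned to [ord0] with weight 1, which lets [f] range over all
   functions. *)
pose G (i a k : 'I_N) : C := if i \in S then V a k else (k == ord0)%:R.
have -> : toC (\sum_(s : 'S_N) \sum_(p : 'S_N) \prod_(i in S) B (s i) (p i)) =
    \sum_(f : {ffun 'I_N -> 'I_N}) (\sum_(s : 'S_N) \prod_i G i (s i) (f i)) *
                   (\sum_(s : 'S_N) \prod_i G i (s i) (f i))^*.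
  under [RHS]eq_bigr do rewrite rmorph_sum big_distrlr/=.
  rewrite [RHS]exchange_big/= /toC rmorph_sum; apply: eq_bigr => s _.
  rewrite [RHS]exchange_big/= rmorph_sum; apply: eq_bigr => p _.
  under [RHS]eq_bigr do rewrite rmorph_prod -big_split/=.
  rewrite -(bigA_distr_bigA (fun i k => G i (s i) k * (G i (p i) k)^*)).
  rewrite rmorph_prod big_mkcond/=; apply: eq_bigr => i _; rewrite /G.
  case: ifPn => iS; first exact: BV.
  rewrite [RHS](bigD1 ord0)//= big1 ?addr0 => [|k /negbTE ->].
    by rewrite conjC1 mulr1 rmorph1.
  by rewrite mul0r.
by apply: sumr_ge0 => f _; exact: mul_conjC_ge0.
Qed.

Lemma perm_coef_set0 : perm_coef finset.set0 = 1.
Proof.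
have F0 : N`!%:R != 0 :> R by rewrite pnatr_eq0 -lt0n fact_gt0.
rewrite /perm_coef cards0 expr0.
under eq_bigr do under eq_bigr do rewrite big_set0.
rewrite !sumr_const !card_Sn -[_ *+ _ *+ _]mulr_natr.
move: (N`!%:R) F0 => F F0.
by field.
Qed.

(** By symmetry the sum over [p] is the same for every position; adding up the [N] positions gives
    full rows of [B], which sum to zero. *)
Lemma perm_coef_set1 i : perm_coef [set i] = 0.
Proof.
rewrite /perm_coef big1 ?mulr0// => s _.
under eq_bigr do rewrite big_set1.
have X i' : \sum_(p : 'S_N) B (s i) (p i') = \sum_(p : 'S_N) B (s i) (p i).
  rewrite (reindex_inj (mulgI (tperm i i')))/=; apply: eq_bigr => p _.
  by rewrite permM tpermR.
suff : N%:R * \sum_(p : 'S_N) B (s i) (p i) = 0.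
  by move=> /eqP; rewrite mulf_eq0 pnatr_eq0/= => /eqP.
transitivity (\sum_(i' < N) \sum_(p : 'S_N) B (s i) (p i')).
  by under [RHS]eq_bigr do rewrite X; rewrite sumr_const card_ord mulr_natl.
rewrite exchange_big/= big1// => p _.
by rewrite -[RHS](Brow (s i)) [RHS](reindex_inj (@perm_inj _ p)).
Qed.

(* All the coefficients of [scaled_perm] are nonnegative and the linear one
   vanishes, so that [(scaled_perm t - 1) / t ^+ 2] is nondecreasing. *)
Lemma scaled_perm1_le t : 1 <= t ->
  t ^+ 2 * (scaled_perm 1 - 1) <= scaled_perm t - 1.
Proof.
move=> t1; have t0 : 0 <= t by rewrite (le_trans _ t1).
have E u : scaled_perm u - 1 =
    \sum_(S : {set 'I_N} | S != finset.set0) u ^+ #|S| * perm_coef S.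
  rewrite scaled_perm_expand (bigD1 finset.set0)//= cards0 expr0 mul1r perm_coef_set0.
  by rewrite [1 + _]addrC addrK.
rewrite !E mulr_sumr; apply: ler_sum => S S0.
rewrite expr1n mul1r; have [/cards1P[i ->]|S1] := boolP (#|S| == 1%N).
  by rewrite perm_coef_set1 !mulr0.
rewrite ler_wpM2r ?perm_coef_ge0// ler_weXn2l//.
by rewrite -cards_eq0 in S0; case: #|S| S0 S1 => [|[|]].
Qed.

End real_spectral.

(** * Permanent bounds from the trace *)

Section doubly_stochastic.
Context {R : realType}.

(** Weierstrass's inequality: the product of the [1 - x k] is at least [1 - \sum_k x k]. *)
Lemma prod_inv_1sub_le (I : finType) (x : I -> R) (s : R) :
  (forall k, 0 <= x k) -> \sum_k x k <= s -> s < 1 ->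
  \prod_k (1 - x k)^-1 <= (1 - s)^-1.
Proof.
move=> x0 xs s1.
have xs1 : \sum_k x k < 1 by exact: le_lt_trans xs s1.
have xk1 k : x k < 1.
  by apply: le_lt_trans xs1; rewrite (bigD1 k)//= lerDl sumr_ge0.
have [P0 [P1 PS]] : 0 <= \prod_k (1 - x k) /\ \prod_k (1 - x k) <= 1 /\
    1 - \sum_k x k <= \prod_k (1 - x k).
  elim/big_rec2: _ => [|k S p _ [p0 [p1 IH]]]; first by rewrite ler01 lexx subr0.
  have h1 : 0 <= 1 - x k by rewrite subr_ge0 ltW.
  split; first by rewrite mulr_ge0.
  split; first by rewrite mulr_ile1// lerBlDr lerDl.
  have := x0 k; nra.
rewrite prodfV lef_pV2 ?posrE ?subr_gt0//; first by lra.
by rewrite (lt_le_trans _ PS)// subr_gt0.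
Qed.

Variable n : nat.
Local Notation N := n.+1.
Variable a : 'I_N -> 'I_N -> R.
Hypothesis asym : forall i j, a i j = a j i.
Hypothesis arow : forall i, \sum_j a i j = N%:R.
Hypothesis apsd : forall x : 'I_N -> R, 0 <= \sum_i \sum_j x i * a i j * x j.

(** The normalized permanent of [a / N], that is [scaled_perm B 1]. For the overlap matrix below it
    is one plus the chi-square divergence. *)
Definition mean_perm : R := N`!%:R^-1 * \sum_(s : 'S_N) \prod_i a i (s i).

Let B i j := a i j / N%:R - N%:R^-1.

Let N0 : 0 < N%:R :> R. Proof. by rewrite ltr0n. Qed.

Let N0' : N%:R != 0 :> R. Proof. by rewrite gt_eqF. Qed.

Let Bsym i j : B i j = B j i. Proof. by rewrite /B asym. Qed.

Let Brow i : \sum_j B i j = 0.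
Proof.
rewrite /B sumrB -mulr_suml arow sumr_const card_ord -[_^-1 *+ _]mulr_natl.
by rewrite mulfV// subrr.
Qed.

Let quadE (x : 'I_N -> R) : \sum_i \sum_j x i * B i j * x j =
  (\sum_i \sum_j x i * a i j * x j - (\sum_i x i) ^+ 2) / N%:R.
Proof.
rewrite expr2 big_distrlr/= -sumrB mulr_suml; apply: eq_bigr => i _.
rewrite -sumrB mulr_suml; apply: eq_bigr => j _; rewrite /B.
by field.
Qed.

(** Rows and columns of [B] sum to zero, so [x] may be centred, and then the negative square in
    [quadE] disappears. *)
Let Bpsd x : 0 <= \sum_i \sum_j x i * B i j * x j.
Proof.
pose m := (\sum_i x i) / N%:R; pose y i := x i - m.
have Bcol j : \sum_i B i j = 0.
  by rewrite -[RHS](Brow j); apply: eq_bigr => i _; rewrite Bsym.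
have -> : \sum_i \sum_j x i * B i j * x j = \sum_i \sum_j y i * B i j * y j.
  have -> : \sum_i \sum_j y i * B i j * y j =
      \sum_i \sum_j (x i * B i j * x j) - \sum_i (x i * m) * (\sum_j B i j)
      - \sum_i m * (\sum_j B i j * x j) + \sum_i m * m * (\sum_j B i j).
    rewrite -!sumrB -big_split/=; apply: eq_bigr => i _.
    rewrite !mulr_sumr -!sumrB -big_split/=; apply: eq_bigr => j _.
    by rewrite /y; ring.
  rewrite [X in _ - X - _ + _]big1 => [|i _]; last by rewrite Brow mulr0.
  rewrite [X in _ + X]big1 => [|i _]; last by rewrite Brow mulr0.
  rewrite -mulr_sumr [\sum_i \sum_j B i j * x j]exchange_big/=.
  rewrite [X in _ - _ * X]big1 => [|i _]; last by rewrite -mulr_suml Bcol mul0r.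
  by rewrite mulr0 !subr0 addr0.
rewrite quadE; have -> : \sum_i y i = 0.
  rewrite /y sumrB sumr_const card_ord -[m *+ _]mulr_natl /m mulrC divfK//.
  by rewrite subrr.
by rewrite expr0n subr0 divr_ge0// ltW.
Qed.

Let mean_permE : mean_perm = scaled_perm B 1.
Proof.
rewrite /mean_perm /scaled_perm mulrAC [RHS]mulrC; congr (_ * _).
rewrite mulr_sumr; apply: eq_bigr => s _.
have -> : N%:R ^+ N = \prod_(i < N) (N%:R : R) by rewrite prodr_const card_ord.
rewrite -big_split/=; apply: eq_bigr => i _.
by rewrite /B; field.
Qed.

Let BE : \sum_i B i i = (\sum_i a i i) / N%:R - 1.
Proof.
rewrite /B sumrB -mulr_suml sumr_const card_ord -[_^-1 *+ _]mulr_natl.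
by rewrite mulfV.
Qed.

Lemma mean_perm_le_trace (tau : R) : tau < 1 ->
  (\sum_i a i i) / N%:R <= 1 + tau -> mean_perm <= (1 - tau)^-1.
Proof.
move=> tau1 atau; rewrite mean_permE.
have [lam [lam0 lamS _ H]] := scaled_perm_le Bsym Brow Bpsd.
have lS : \sum_k lam k <= tau by rewrite lamS BE lerBlDl.
apply: (le_trans (H 1 ler01 _)) => [k|].
  rewrite mul1r; apply: le_lt_trans tau1; apply: le_trans lS.
  by rewrite (bigD1 k)//= lerDl sumr_ge0.
under eq_bigr do rewrite mul1r.
exact: prod_inv_1sub_le.
Qed.

Lemma mean_perm_le_sqr (tau : R) : 0 <= tau <= 1 / 2 ->
  (\sum_i a i i) / N%:R <= 1 + tau -> mean_perm - 1 <= 4 * tau ^+ 2.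
Proof.
move=> /andP[tau0 tau1] atau; have [t0|t0] := eqVneq tau 0.
  have := @mean_perm_le_trace 0 ltr01.
  rewrite t0 in atau *; move=> /(_ atau); rewrite subr0 invr1 => h.
  by rewrite expr0n mulr0; lra.
have {t0}tau0 : 0 < tau by rewrite lt_neqAle eq_sym t0.
rewrite mean_permE.
have [lam [lam0 lamS _ H]] := scaled_perm_le Bsym Brow Bpsd.
have lS : \sum_k lam k <= tau by rewrite lamS BE lerBlDl.
(* With this [t] the eigenvalues of [t * B] sum to at most 1/2, whence [scaled_perm B t <= 2].
   Dividing by [t ^+ 2] yields [4 * tau ^+ 2]; the case [tau = 0] was set apart because of the
   inverse. *)
pose t := (2 * tau)^-1.
have t1 : 1 <= t by rewrite invf_ge1; lra.
have t0 : 0 <= t by lra.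
have tS : \sum_k t * lam k <= 1 / 2.
  rewrite -mulr_sumr /t mulrC ler_pdivrMr; lra.
have := scaled_perm1_le Bsym Brow Bpsd t1.
have Ft : scaled_perm B t <= 2.
  apply: (le_trans (H t t0 _)) => [k|].
    apply: (@le_lt_trans _ _ (1 / 2)); last by lra.
    apply: le_trans tS.
    by rewrite (bigD1 k)//= lerDl sumr_ge0// => i _; rewrite mulr_ge0.
  have -> : 2 = (1 - 1 / 2 : R)^-1 by field.
  apply: prod_inv_1sub_le => //; last by lra.
  by move=> k; rewrite mulr_ge0.
move=> h; have {}h : t ^+ 2 * (scaled_perm B 1 - 1) <= 1 by lra.
have tt : t * (2 * tau) = 1 by rewrite /t mulVf//; lra.
have -> : 4 * tau ^+ 2 = (2 * tau) ^+ 2 by ring.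
have := @ler_wpM2l _ ((2 * tau) ^+ 2) (sqr_ge0 _) _ _ h.
by rewrite mulr1 mulrA -exprMn [2 * tau * t]mulrC tt expr1n mul1r.
Qed.

(* The minorization [expR (- L) <= a i j] bounds the nontrivial eigenvalues of
   [a / N] by [1 - expR (- L)]. *)
Lemma mean_perm_le_expR (tau L : R) : 0 <= L ->
  (forall i j, expR (- L) <= a i j) ->
  (\sum_i a i i) / N%:R <= 1 + tau -> mean_perm <= expR (2 * (1 + L) * tau).
Proof.
move=> L0 aL atau; rewrite mean_permE.
have [lam [lam0 lamS lamc H]] := scaled_perm_le Bsym Brow Bpsd.
have lS : \sum_k lam k <= tau by rewrite lamS BE lerBlDl.
set e := expR (- L) in aL.
have e0 : 0 < e by exact: expR_gt0.
(* Subtracting [e] leaves nonnegative entries with row sums [N * (1 - e)];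
   [x i * x j <= (x i ^+ 2 + x j ^+ 2) / 2] then bounds the form, and the remaining
   [(e - 1) * (\sum_i x i) ^+ 2] is nonpositive. *)
have lamL : forall k, lam k <= 1 - e.
  apply: lamc => x; rewrite quadE ler_pdivrMr//.
  have [c0 crow] : (forall i j, 0 <= a i j - e) /\
      (forall i, \sum_j (a i j - e) = N%:R * (1 - e)).
    split=> [i j|i]; first by rewrite subr_ge0.
    by rewrite sumrB arow sumr_const card_ord -[e *+ _]mulr_natl; ring.
  have e1 : e <= 1 by rewrite -expR0 ler_expR oppr_le0.
  have -> : \sum_i \sum_j x i * a i j * x j =
    \sum_i \sum_j (a i j - e) * (x i * x j) + e * (\sum_i x i) ^+ 2.
    rewrite expr2 big_distrlr/= mulr_sumr -big_split/=; apply: eq_bigr => i _.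
    rewrite mulr_sumr -big_split/=; apply: eq_bigr => j _; ring.
  have : \sum_i \sum_j (a i j - e) * (x i * x j) <=
      (1 - e) * (\sum_i x i ^+ 2) * N%:R.
    have -> : (1 - e) * (\sum_i x i ^+ 2) * N%:R =
        \sum_i \sum_j (a i j - e) * ((x i ^+ 2 + x j ^+ 2) / 2).
      have S1 : \sum_i \sum_j (a i j - e) * (x i ^+ 2 / 2) =
          (1 - e) * (\sum_i x i ^+ 2) * N%:R / 2.
        under eq_bigr do rewrite -mulr_suml crow.
        rewrite -mulr_sumr -mulr_suml; ring.
      have S2 : \sum_i \sum_j (a i j - e) * (x j ^+ 2 / 2) =
          (1 - e) * (\sum_i x i ^+ 2) * N%:R / 2.
        rewrite -S1 exchange_big/=; apply: eq_bigr => i _; apply: eq_bigr => j _.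
        by rewrite asym.
      rewrite [LHS](_ : _ = (1 - e) * (\sum_i x i ^+ 2) * N%:R / 2 +
        (1 - e) * (\sum_i x i ^+ 2) * N%:R / 2); last by field.
      rewrite -{1}S1 -S2 -big_split/=; apply: eq_bigr => i _.
      rewrite -big_split/=; apply: eq_bigr => j _; by field.
    apply: ler_sum => i _; apply: ler_sum => j _; rewrite ler_wpM2l//.
    have := sqr_ge0 (x i - x j); rewrite sqrrB; lra.
  have := sqr_ge0 (\sum_i x i); nra.
have lam1 k : lam k < 1 by apply: (le_lt_trans (lamL k)); lra.
apply: (le_trans (H 1 ler01 _)) => [k|]; first by rewrite mul1r.
apply: (@le_trans _ _ (\prod_k expR (2 * (1 + L) * lam k))); last first.
  rewrite -expR_sum ler_expR -mulr_sumr ler_wpM2l//; lra.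
apply: ler_prod => k _; rewrite mul1r invr_ge0 subr_ge0 (ltW (lam1 k))/=.
have k0 := lam0 k; have k1 := lam1 k.
(* Up to 1/2, [(1 - lam k)^-1 <= 1 + 2 * lam k]; beyond it, [(1 - lam k)^-1 <= expR L] and
   [L <= 2 * L * lam k]. *)
have [lk|lk] := leP (lam k) (1 / 2).
  apply: (@le_trans _ _ (1 + 2 * lam k)).
    rewrite invf_ple ?posrE; [|lra|lra].
    rewrite -div1r ler_pdivrMr; nra.
  apply: (le_trans (expR_ge1Dx _)); rewrite ler_expR; nra.
apply: (@le_trans _ _ (expR L)).
  rewrite -[expR L]invrK -expRN lef_pV2 ?posrE//; last by lra.
  by have := lamL k; rewrite -/e; lra.
rewrite ler_expR; nra.
Qed.

End doubly_stochastic.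

(** * The chi-square divergence as a permanent *)

Section densities.
Local Open Scope ereal_scope.
Context d (T : measurableType d) (R : realType).

Import HBNNSimple.

(** From indicators to simple functions by linearity, then to [f] by monotone convergence. [nu] is
    left general to cover Lebesgue, counting and Bernoulli reference measures. *)
Lemma integral_density (nu m : {measure set T -> \bar R}) (g : T -> R) :
  measurable_fun [set: T] g -> (forall x, (0 <= g x)%R) ->
  (forall A, measurable A -> m A = \int[nu]_(x in A) (g x)%:E) ->
  forall f : T -> \bar R, measurable_fun [set: T] f -> (forall x, 0 <= f x) ->
  \int[m]_x f x = \int[nu]_x (f x * (g x)%:E).
Proof.
move=> mg g0 mE f mf f0.
have mT : @measurable _ T [set: T] by [].
pose h := nnsfun_approx mT mf.
have mh n : measurable_fun [set: T] (EFin \o h n).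
  by apply/measurable_EFinP; exact/measurable_funP.
have -> : \int[m]_x f x = lim (\int[m]_x (EFin \o h n) x @[n --> \oo]).
  have fE x : f x = lim ((EFin \o h n) x @[n --> \oo]).
    by apply/esym/cvg_lim => //; exact: cvg_nnsfun_approx.
  under eq_integral => x _ do rewrite fE.
  apply: monotone_convergence => //.
  - by move=> n x _ //=; rewrite lee_fin.
  - by move=> x _ a b ab; rewrite lee_fin; exact/lefP/nd_nnsfun_approx.
have -> : \int[nu]_x (f x * (g x)%:E) =
    lim (\int[nu]_x ((EFin \o h n) x * (g x)%:E) @[n --> \oo]).
  have fg x : f x * (g x)%:E = lim ((EFin \o h n) x * (g x)%:E @[n --> \oo]).
    by apply/esym/cvg_lim => //; apply: cvgeZr => //; exact: cvg_nnsfun_approx.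
  under eq_integral => x _ do rewrite fg.
  apply: monotone_convergence => //.
  - by move=> n; apply: emeasurable_funM => //; exact/measurable_EFinP.
  - by move=> n x _; rewrite mule_ge0// lee_fin.
  - move=> x _ a b ab; rewrite lee_wpmul2r ?lee_fin//.
    exact/lefP/nd_nnsfun_approx.
congr (lim (_ @ \oo)); apply/funext => n.
have step (r : R) : (0 <= r)%R -> \int[m]_x (r * \1_(h n @^-1` [set r]) x)%:E =
    \int[nu]_x ((r * \1_(h n @^-1` [set r]) x)%:E * (g x)%:E).
  move=> r0; have mA : measurable (h n @^-1` [set r]) by [].
  under eq_integral do rewrite EFinM.
  rewrite ge0_integralZl//; last by apply/measurable_EFinP.
  under [RHS]eq_integral do rewrite EFinM -muleA.
  rewrite [RHS]ge0_integralZl//; last 2 first.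
  - by apply: emeasurable_funM; exact/measurable_EFinP.
  - by move=> x _; rewrite mule_ge0// lee_fin.
  congr (_ * _); rewrite integral_indic// setIT mE// integral_mkcond.
  by apply: eq_integral => x _; rewrite epatch_indic muleC.
transitivity (\int[m]_x (\sum_(y \in range (h n))
    (y * \1_(h n @^-1` [set y]) x)%:E)).
  by apply: eq_integral => t _; rewrite /= fimfunE -fsumEFin.
rewrite ge0_integral_fsum//; last 2 first.
  - by move=> y; apply/measurable_EFinP/measurable_funM.
  - by move=> y x _; exact: nnfun_muleindic_ge0.
transitivity (\int[nu]_x (\sum_(y \in range (h n))
    ((y * \1_(h n @^-1` [set y]) x)%:E * (g x)%:E))); last first.
  apply: eq_integral => x _.
  rewrite -ge0_mule_fsuml => [|y]; last exact: nnfun_muleindic_ge0.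
  by rewrite fsumEFin // -(fimfunE _ x).
rewrite ge0_integral_fsum//; last 2 first.
  - move=> y; apply: emeasurable_funM; apply/measurable_EFinP => //.
    exact: measurable_funM.
  - move=> y x _; apply: mule_ge0; last by rewrite lee_fin.
    exact: nnfun_muleindic_ge0.
apply: eq_fsbigr => r; rewrite inE => -[t _ <-].
exact: step.
Qed.

Lemma integral_unif_mixture (I : finType) (i0 : I) (F : I -> probability T R)
    (f : T -> \bar R) :
  measurable_fun [set: T] f -> (forall x, 0 <= f x) ->
  \int[unif_mixture i0 F]_x f x =
  (#|I|%:R^-1)%:E * \sum_(i : I) \int[F i]_x f x.
Proof.
move=> mf f0.
have c0 : (0 <= #|I|%:R^-1 :> R)%R by rewrite invr_ge0.
(* The components are enumerated by naturals to use the sum of a sequence of measures; the default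
   [F i0] lies beyond the range summed. *)
pose G (k : nat) : {measure set T -> \bar R} :=
  if insub k is Some i then F (enum_val (i : 'I_#|I|)) else F i0.
pose m := mscale (NngNum c0) (msum G #|I|).
have sumG (w : {measure set T -> \bar R} -> \bar R) :
    \sum_(k < #|I|) w (G k) = \sum_(i : I) w (F i).
  rewrite [RHS](reindex (@enum_val I predT))/=; last first.
    by apply: onW_bij; exact: enum_val_bij.
  by apply: eq_bigr => k _; rewrite /G valK.
rewrite (@eq_measure_integral _ _ _ _ m) => [|A mA _].
  rewrite ge0_integral_mscale//= ge0_integral_measure_sum//.
  by rewrite (sumG (fun m => \int[m]_x f x)).
rewrite /m /= /mscale/= /msum/= (sumG (fun m => m A)).
by [].
Qed.

Lemma integral_prod_probS n (P : 'I_n.+1 -> probability T R)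
    (f : n.+1.-tuple T -> \bar R) :
  measurable_fun [set: n.+1.-tuple T] f -> (forall x, 0 <= f x) ->
  \int[prod_prob P]_x f x =
  \int[P ord0]_x \int[prod_prob (fun i => P (lift ord0 i))]_y f (tcons (x, y)).
Proof.
move=> mf f0 /=.
rewrite ge0_integral_distribution//.
rewrite fubini_tonelli1//.
by apply: measurableT_comp => //; exact: measurable_tcons.
by move=> x; exact: f0.
Qed.

Lemma measurable_prod_tnth n (f : 'I_n -> T -> R) :
  (forall i, measurable_fun [set: T] (f i)) ->
  measurable_fun [set: n.-tuple T] (fun x => \prod_i f i (tnth x i))%R.
Proof.
move=> mf; apply: measurable_prod => i _.
by apply: measurableT_comp => //; exact: measurable_tnth.
Qed.

Lemma prod_tcons n (f : 'I_n.+1 -> T -> R) x (y : n.-tuple T) :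
  (\prod_i f i (tnth (tcons (x, y)) i) =
   f ord0 x * \prod_i f (lift ord0 i) (tnth y i))%R.
Proof.
rewrite big_ord_recl; congr (_ * _)%R.
by apply: eq_bigr => i _; rewrite tnthS.
Qed.

(** Having a density is phrased through integrals of nonnegative functions, the form that Tonelli's
    theorem reproduces in the induction. *)
Lemma prod_prob_density n (P Q : 'I_n -> probability T R) (f : 'I_n -> T -> R) :
  (forall i, measurable_fun [set: T] (f i)) -> (forall i x, (0 <= f i x)%R) ->
  (forall i (h : T -> \bar R), measurable_fun [set: T] h -> (forall x, 0 <= h x) ->
    \int[P i]_x h x = \int[Q i]_x (h x * (f i x)%:E)) ->
  forall h : n.-tuple T -> \bar R,
  measurable_fun [set: n.-tuple T] h -> (forall x, 0 <= h x) ->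
  \int[prod_prob P]_x h x =
  \int[prod_prob Q]_x (h x * (\prod_i f i (tnth x i))%:E).
Proof.
elim: n P Q f => [|n IH] P Q f mf f0 PQ h mh h0.
  by apply: eq_integral => x _; rewrite big_ord0 mule1.
have mp := measurable_prod_tnth mf.
have p0 x : (0 <= \prod_i f i (tnth x i))%R by apply: prodr_ge0.
have mhp : measurable_fun [set: n.+1.-tuple T]
    (fun x => h x * (\prod_i f i (tnth x i))%:E).
  by apply: emeasurable_funM => //; exact/measurable_EFinP.
rewrite !integral_prod_probS//; last by move=> x; rewrite mule_ge0// lee_fin.
pose p' (y : n.-tuple T) := (\prod_i f (lift ord0 i) (tnth y i))%R.
have mp' : measurable_fun [set: n.-tuple T] p'.
  exact: (@measurable_prod_tnth n (fun i => f (lift ord0 i)) (fun i => mf _)).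
have p'0 y : (0 <= p' y)%R by apply: prodr_ge0.
have mht : measurable_fun [set: T * n.-tuple T] (h \o @tcons _ T n).
  exact: (measurableT_comp mh (@measurable_tcons _ T n)).
have mhx x : measurable_fun [set: n.-tuple T] (fun y => h (tcons (x, y))).
  exact: (measurableT_comp mht (@pair1_measurable _ _ T (n.-tuple T) x)).
under eq_integral => x _ do rewrite (IH _ (fun i => Q (lift ord0 i))
  (fun i => f (lift ord0 i)) _ _ (fun i => PQ (lift ord0 i)) _ (mhx x))//.
have mF : measurable_fun [set: T * n.-tuple T]
    (fun z => h (tcons z) * (p' z.2)%:E).
  apply: emeasurable_funM => //; apply/measurable_EFinP.
  exact: measurableT_comp.
rewrite PQ; last 2 first.
- apply: (measurable_fun_fubini_tonelli_F _ mF) => z.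
  by apply: mule_ge0; [exact: h0|rewrite lee_fin].
- by move=> x; apply: integral_ge0 => y _; apply: mule_ge0; [exact: h0|exact: p'0].
apply: eq_integral => x _; rewrite -ge0_integralZr//; last 3 first.
- by apply: emeasurable_funM => //; exact/measurable_EFinP.
- by move=> y _; apply: mule_ge0; [exact: h0|exact: p'0].
- by rewrite lee_fin.
by apply: eq_integral => y _; rewrite prod_tcons -muleA -EFinM [(_ * f _ _)%R]mulrC.
Qed.

Lemma integral_prod_prob n (Q : 'I_n -> probability T R) (f : 'I_n -> T -> R) :
  (forall i, measurable_fun [set: T] (f i)) -> (forall i x, (0 <= f i x)%R) ->
  \int[prod_prob Q]_x (\prod_i f i (tnth x i))%:E =
  \prod_i \int[Q i]_x (f i x)%:E.
Proof.
elim: n Q f => [|n IH] Q f mf f0.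
  rewrite big_ord0; under eq_integral do rewrite big_ord0.
  by rewrite integral_cst//= diracT mule1.
have mp := measurable_prod_tnth mf.
rewrite integral_prod_probS; last 2 first.
- exact/measurable_EFinP.
- by move=> x; rewrite lee_fin prodr_ge0.
have mp' := @measurable_prod_tnth n (fun i => f (lift ord0 i)) (fun i => mf _).
have p'0 (y : n.-tuple T) : (0 <= \prod_i f (lift ord0 i) (tnth y i))%R.
  exact: prodr_ge0.
rewrite big_ord_recl -IH//.
have inner x : \int[prod_prob (fun i => Q (lift ord0 i))]_y
    (\prod_i f i (tnth (tcons (x, y)) i))%:E = (f ord0 x)%:E *
    \int[prod_prob (fun i => Q (lift ord0 i))]_y
      (\prod_i f (lift ord0 i) (tnth y i))%:E.
  under eq_integral do rewrite prod_tcons EFinM.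
  rewrite ge0_integralZl_EFin//.
  - by move=> y _; rewrite lee_fin.
  - exact/measurable_EFinP.
under eq_integral do rewrite inner.
rewrite ge0_integralZr//.
- exact/measurable_EFinP.
- by move=> x _; rewrite lee_fin.
- by apply: integral_ge0 => y _; rewrite lee_fin.
Qed.

End densities.

(** * The divergence as the permanent of the overlap matrix *)

Section chi2_permutation_mixture.
Local Open Scope ereal_scope.
Context d (T : measurableType d) (R : realType).
Variables (n : nat) (P : 'I_n.+1 -> probability T R).
Local Notation N := n.+1.
Let Pbar : probability T R := unif_mixture (ord0 : 'I_N) P.
Variable f : 'I_N -> T -> R.
Hypothesis mf : forall i, measurable_fun [set: T] (f i).
Hypothesis f0 : forall i x, (0 <= f i x)%R.
Hypothesis fN : forall i x, (f i x <= N%:R)%R.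
Hypothesis Pf : forall i (h : T -> \bar R), measurable_fun [set: T] h ->
  (forall x, 0 <= h x) -> \int[P i]_x h x = \int[Pbar]_x (h x * (f i x)%:E).

Let Q : probability (N.-tuple T) R := iid_mean_prod P.

(** [N] times the matrix [A] of the overview; the bound [fN] makes the integral finite. *)
Definition overlap (i j : 'I_N) : R := fine (\int[Pbar]_x (f i x * f j x)%:E).

Let mff i j : measurable_fun [set: T] (fun x => f i x * f j x)%R.
Proof. exact: measurable_funM. Qed.

Lemma overlapE i j : (overlap i j)%:E = \int[Pbar]_x (f i x * f j x)%:E.
Proof.
rewrite /overlap fineK// ge0_fin_numE; last first.
  by apply: integral_ge0 => x _; rewrite lee_fin mulr_ge0.
apply: (@le_lt_trans _ _ (\int[Pbar]_x (N%:R * N%:R)%:E)).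
  apply: ge0_le_integral => //.
  - by move=> x _; rewrite lee_fin mulr_ge0.
  - exact/measurable_EFinP.
  - by move=> x _; rewrite lee_fin ler_pM.
rewrite integral_cst// [X in _ * X](_ : _ = 1) ?mule1 ?ltry//.
exact: (probability_setT Pbar).
Qed.

(** The likelihood ratio of the permutation mixture against the iid product. *)
Let D (x : N.-tuple T) : R :=
  (N`!%:R^-1 * \sum_(s : 'S_N) \prod_i f (s i) (tnth x i))%R.

Let mprod (s : 'S_N) :
  measurable_fun [set: N.-tuple T] (fun x => \prod_i f (s i) (tnth x i))%R.
Proof. exact: (@measurable_prod_tnth _ _ _ _ (fun i => f (s i)) (fun i => mf _)). Qed.

Let prod0 (s : 'S_N) (x : N.-tuple T) : (0 <= \prod_i f (s i) (tnth x i))%R.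
Proof. exact: prodr_ge0. Qed.

Let mD : measurable_fun [set: N.-tuple T] D.
Proof.
apply: measurable_funM => //.
by apply: measurable_sum => s; exact: mprod.
Qed.

Let D0 x : (0 <= D x)%R.
Proof. by rewrite mulr_ge0 ?invr_ge0 ?sumr_ge0. Qed.

Let integralD (h : N.-tuple T -> \bar R) :
  measurable_fun [set: N.-tuple T] h -> (forall x, 0 <= h x) ->
  \int[Q]_x (h x * (D x)%:E) = (N`!%:R^-1)%:E * \sum_(s : 'S_N)
    \int[Q]_x (h x * (\prod_i f (s i) (tnth x i))%:E).
Proof.
move=> mh h0.
have mhs (s : 'S_N) : measurable_fun [set: N.-tuple T]
    (fun x => h x * (\prod_i f (s i) (tnth x i))%:E).
  by apply: emeasurable_funM => //; exact/measurable_EFinP.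
have hs0 (s : 'S_N) x : 0 <= h x * (\prod_i f (s i) (tnth x i))%:E.
  by apply: mule_ge0; [exact: h0|rewrite lee_fin].
rewrite -ge0_integral_sum// -ge0_integralZl_EFin//.
- apply: eq_integral => x _; rewrite /D EFinM muleCA; congr (_ * _).
  by rewrite -sumEFin ge0_sume_distrr// => s _; rewrite lee_fin.
- by move=> x _; apply: sume_ge0 => s _.
- exact: emeasurable_sum.
Qed.

Let permuted_density (h : N.-tuple T -> \bar R) :
  measurable_fun [set: N.-tuple T] h -> (forall x, 0 <= h x) ->
  \int[permuted_prod P]_x h x = \int[Q]_x (h x * (D x)%:E).
Proof.
move=> mh h0; rewrite integralD// /permuted_prod integral_unif_mixture//.
rewrite card_Sn; congr (_ * _); apply: eq_bigr => s _.
rewrite (@prod_prob_density _ _ _ _ _ (fun=> Pbar) (fun i => f (s i)))//.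
by move=> i k mk k0; exact: Pf.
Qed.

Let permutedE A : measurable A ->
  permuted_prod P A = \int[Q]_(x in A) (D x)%:E.
Proof.
move=> mA; rewrite -[A in LHS]setIT -integral_indic// permuted_density//.
- rewrite [RHS]integral_mkcond; apply: eq_integral => x _.
  by rewrite epatch_indic muleC.
- exact/measurable_EFinP.
Qed.

Let permuted_dominates : permuted_prod P `<< Q.
Proof.
apply/null_content_dominatesP => A mA QA0; rewrite permutedE//.
by apply: null_set_integral => //; apply/measurable_funTS/measurable_EFinP.
Qed.

Let integralDT : \int[Q]_x (D x)%:E = 1.
Proof. by rewrite -permutedE// probability_setT. Qed.

Let integral_prod_tnth (s p : 'S_N) :
  \int[Q]_x ((\prod_i f (s i) (tnth x i))%:E * (\prod_i f (p i) (tnth x i))%:E) =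
  (\prod_i overlap (s i) (p i))%:E.
Proof.
have := @integral_prod_prob _ T R N (fun=> Pbar)
  (fun i x => f (s i) x * f (p i) x)%R (fun i => mff _ _) _.
rewrite -/Q => /(_ _)/esym H; rewrite -prodEFin.
transitivity (\prod_(i < N) \int[Pbar]_x (f (s i) x * f (p i) x)%:E).
  rewrite H => [|i x]; last by rewrite mulr_ge0.
  by apply: eq_integral => x _; rewrite -EFinM big_split.
by apply: eq_bigr => i _; rewrite overlapE.
Qed.

(** Squaring [D] gives a double average over permutations; relabelling the coordinates shows that
    the inner average is the same for every [s]. *)
Let integralD2 : \int[Q]_x ((D x)%:E * (D x)%:E) = (mean_perm overlap)%:E.
Proof.
have mED : measurable_fun [set: N.-tuple T] (fun x => (D x)%:E).
  exact/measurable_EFinP.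
have ED0 x : 0 <= (D x)%:E by rewrite lee_fin.
rewrite integralD//.
have step (s : 'S_N) : \int[Q]_x ((D x)%:E * (\prod_i f (s i) (tnth x i))%:E) =
    (mean_perm overlap)%:E.
  under eq_integral do rewrite muleC.
  rewrite integralD//; last 2 first.
  - exact/measurable_EFinP.
  - by move=> x; rewrite lee_fin.
  under eq_bigr do rewrite integral_prod_tnth.
  rewrite sumEFin -EFinM /mean_perm; congr ((_ * _)%:E)%R.
  rewrite (reindex_inj (mulgI s))/=; apply: eq_bigr => p _.
  rewrite [RHS](reindex_inj (@perm_inj _ s))/=.
  by apply: eq_bigr => i _; rewrite permM.
under eq_bigr do rewrite step.
rewrite sumEFin -EFinM sumr_const card_Sn.
rewrite -[(mean_perm _ *+ _)%R]mulr_natl mulrA mulVf ?mul1r//.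
Qed.

Lemma chi2_permutedE :
  chi2 (permuted_prod P) (iid_mean_prod P) = (mean_perm overlap - 1)%:E.
Proof.
rewrite /chi2 asboolT; last exact: permuted_dominates.
rewrite -/Q; set g := Radon_Nikodym _ _.
have mg : measurable_fun [set: N.-tuple T] g.
  by apply: measurable_int; apply: Radon_Nikodym_integrable.
have intD : Q.-integrable [set: N.-tuple T] (fun x => (D x)%:E).
  apply/integrableP; split; first exact/measurable_EFinP.
  under eq_integral do rewrite gee0_abs ?lee_fin//.
  by rewrite integralDT ltry.
(* The Radon-Nikodym derivative is only known through its integrals, which identify it with [D]
   almost everywhere. *)
have gD : ae_eq Q [set: N.-tuple T] g (fun x => (D x)%:E).
  apply: integral_ae_eq => //; first exact: Radon_Nikodym_integrable.
    exact/measurable_EFinP.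
  move=> E _ mE; rewrite -permutedE// -Radon_Nikodym_integral//.
have -> : \int[Q]_x (g x - 1) ^+ 2 = \int[Q]_x (((D x - 1) ^+ 2)%:E).
  apply: ae_eq_integral => //.
  - under eq_fun do rewrite expe2.
    by apply: emeasurable_funM; exact: emeasurable_funB.
  - apply/measurable_EFinP; apply: measurable_funX; exact: measurable_funB.
  apply: filterS gD => x gDx Dx; rewrite gDx//.
have m2 : measurable_fun [set: N.-tuple T] (fun x => ((D x - 1) ^+ 2)%R).
  by apply: measurable_funX; exact: measurable_funB.
(* [(D - 1)^2 + 2 D = D^2 + 1], kept free of subtractions so that only integrals of nonnegative
   functions occur. *)
have key : \int[Q]_x (((D x - 1) ^+ 2)%:E) + 2%:E * \int[Q]_x (D x)%:E =
    \int[Q]_x ((D x)%:E * (D x)%:E) + \int[Q]_x 1.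
  rewrite -ge0_integralZl_EFin//; last 2 first.
  - by move=> x _; rewrite lee_fin.
  - exact/measurable_EFinP.
  rewrite -!ge0_integralD//.
  - apply: eq_integral => x _; rewrite -!EFinM -!EFinD; congr (_%:E); ring.
  - by move=> x _; rewrite lee_fin mulr_ge0.
  - by apply: emeasurable_funM; exact/measurable_EFinP.
  - by move=> x _; rewrite lee_fin sqr_ge0.
  - exact/measurable_EFinP.
  - by move=> x _; rewrite lee_fin mulr_ge0.
  - by apply: emeasurable_funM => //; exact/measurable_EFinP.
have QT : Q [set: N.-tuple T] = 1 by exact: probability_setT.
move: key; rewrite integralDT integralD2 integral_cst// [X in _ = _ + _ * X]QT !mule1.
set I := \int[Q]_x _; case: I => [r| |]//= [].
move=> e; congr (_%:E); lra.
Qed.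

Lemma overlapC i j : overlap i j = overlap j i.
Proof. by rewrite /overlap; under eq_integral do rewrite mulrC. Qed.

Let overlap_integrable i j : Pbar.-integrable [set: T] (fun x => (f i x * f j x)%:E).
Proof.
apply/integrableP; split; first exact/measurable_EFinP.
under eq_integral do rewrite gee0_abs ?lee_fin ?mulr_ge0//.
by rewrite -overlapE ltry.
Qed.

(** The form is the integral of the square of [\sum_i x i * f i y]. The summands have signs, so the
    exchange with the integral uses integrability and induction on a list of index pairs. *)
Lemma overlap_psd (x : 'I_N -> R) :
  (0 <= \sum_i \sum_j x i * overlap i j * x j)%R.
Proof.
rewrite -lee_fin pair_big/=.
pose h (u : 'I_N * 'I_N) y := ((x u.1 * x u.2)%R)%:E * (f u.1 y * f u.2 y)%:E.
have hi u : Pbar.-integrable [set: T] (h u) by exact: integrableZl.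
have H (s : seq ('I_N * 'I_N)) : (\sum_(u <- s) x u.1 * overlap u.1 u.2 * x u.2)%:E =
    \int[Pbar]_y \sum_(u <- s) h u y.
  elim: s => [|u s IH].
    by rewrite big_nil; under eq_integral do rewrite big_nil; rewrite integral0.
  rewrite big_cons; under eq_integral do rewrite big_cons.
  rewrite lebesgue_integrable.integralD//; last exact: integrable_sum.
  rewrite EFinD IH integralZl// -overlapE -EFinM; congr (_%:E + _); ring.
rewrite H; apply: integral_ge0 => y _.
have -> : \sum_(u : 'I_N * 'I_N) h u y = ((\sum_i x i * f i y) ^+ 2)%:E.
  rewrite expr2 big_distrlr/= pair_big/= -sumEFin; apply: eq_bigr => u _.
  rewrite /h -EFinM; congr (_%:E); ring.
by rewrite lee_fin sqr_ge0.
Qed.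

End chi2_permutation_mixture.

Lemma measurable_fun_inv d (T : measurableType d) (R : realType) (g : T -> R) :
  measurable_fun [set: T] g -> (forall x, 0 <= g x) ->
  measurable_fun [set: T] (fun x => (g x)^-1).
Proof.
move=> mg g0; under eq_fun do rewrite -powR_inv1//.
exact: (measurableT_comp (measurable_powR (-1)) mg).
Qed.

(** * Trace and overlap bounds from densities with respect to a reference measure *)

Section density_bounds.
Local Open Scope ereal_scope.
Context d (T : measurableType d) (R : realType).
Variables (nu : {measure set T -> \bar R}) (n : nat).
Local Notation N := n.+1.
Variables (P : 'I_N -> probability T R) (p : 'I_N -> T -> R).
Hypothesis mp : forall i, measurable_fun [set: T] (p i).
Hypothesis p0 : forall i x, (0 <= p i x)%R.
Hypothesis Pp : forall i A, measurable A -> P i A = \int[nu]_(x in A) (p i x)%:E.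

Let Pbar : probability T R := unif_mixture (ord0 : 'I_N) P.

Let pbar x : R := (N%:R^-1 * \sum_i p i x)%R.

(** Where [pbar] vanishes so does every [p i], and the quotient is 0 by convention; thus
    [f i x * pbar x = p i x] holds at every point. *)
Definition mean_ratio i x : R := (p i x / pbar x)%R.

Local Notation f := mean_ratio.

Let N0 : (0 < N%:R :> R)%R. Proof. by rewrite ltr0n. Qed.

Let pbar0 x : (0 <= pbar x)%R.
Proof. by rewrite mulr_ge0 ?invr_ge0 ?sumr_ge0. Qed.

Let mpbar : measurable_fun [set: T] pbar.
Proof.
by apply: (@measurable_funM _ _ _ _ (fun=> N%:R^-1)%R) => //; apply: measurable_sum.
Qed.

Let p_le i x : (p i x <= N%:R * pbar x)%R.
Proof.
rewrite /pbar mulrA mulfV ?gt_eqF// mul1r (bigD1 i)//= lerDl.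
exact: sumr_ge0.
Qed.

Let pbar_eq0 i x : pbar x = 0%R -> p i x = 0%R.
Proof.
move=> e; apply/eqP; rewrite eq_le p0 andbT.
by have := p_le i x; rewrite e mulr0.
Qed.

Lemma measurable_mean_ratio i : measurable_fun [set: T] (f i).
Proof.
by apply: measurable_funM => //; exact: measurable_fun_inv.
Qed.

Lemma mean_ratio_ge0 i x : (0 <= f i x)%R.
Proof. by rewrite divr_ge0. Qed.

Lemma mean_ratio_le i x : (f i x <= N%:R)%R.
Proof.
have [e|e] := eqVneq (pbar x) 0%R; first by rewrite /f e invr0 mulr0 ltW.
by rewrite ler_pdivrMr ?p_le// lt_neqAle eq_sym e pbar0.
Qed.

Let ratioK i x : (f i x * pbar x = p i x)%R.
Proof.
have [e|e] := eqVneq (pbar x) 0%R; last by rewrite divfK.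
by rewrite e mulr0 pbar_eq0.
Qed.

Lemma sum_mean_ratio_le x : (\sum_j f j x <= N%:R)%R.
Proof.
rewrite /f -mulr_suml; have [e|e] := eqVneq (pbar x) 0%R.
  by rewrite e invr0 mulr0 ltW.
have -> : (\sum_i p i x = N%:R * pbar x)%R.
  by rewrite /pbar mulrA mulfV ?gt_eqF// mul1r.
by rewrite mulfK.
Qed.

Let integralP i (h : T -> \bar R) : measurable_fun [set: T] h ->
  (forall x, 0 <= h x) -> \int[P i]_x h x = \int[nu]_x (h x * (p i x)%:E).
Proof. by move=> mh h0; apply: integral_density => // A; exact: Pp. Qed.

Let integralPbar (h : T -> \bar R) : measurable_fun [set: T] h ->
  (forall x, 0 <= h x) -> \int[Pbar]_x h x = \int[nu]_x (h x * (pbar x)%:E).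
Proof.
move=> mh h0; rewrite integral_unif_mixture// card_ord.
under eq_bigr do rewrite integralP//.
have mhp i : measurable_fun [set: T] (fun x => h x * (p i x)%:E).
  by apply: emeasurable_funM => //; exact/measurable_EFinP.
have hp0 i x : 0 <= h x * (p i x)%:E.
  by apply: mule_ge0; [exact: h0|rewrite lee_fin].
rewrite -ge0_integral_sum// -ge0_integralZl_EFin//.
- apply: eq_integral => x _; rewrite /pbar EFinM muleCA; congr (_ * _).
  by rewrite -sumEFin ge0_sume_distrr// => s _; rewrite lee_fin.
- by move=> x _; apply: sume_ge0 => s _.
- by apply: emeasurable_sum.
Qed.

Lemma integral_mean_ratio i (h : T -> \bar R) : measurable_fun [set: T] h ->
  (forall x, 0 <= h x) -> \int[P i]_x h x = \int[Pbar]_x (h x * (f i x)%:E).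
Proof.
move=> mh h0; rewrite integralP// integralPbar//.
- by apply: eq_integral => x _; rewrite -muleA -EFinM ratioK.
- by apply: emeasurable_funM => //; apply/measurable_EFinP; exact: measurable_mean_ratio.
- by move=> x; apply: mule_ge0; [exact: h0|rewrite lee_fin mean_ratio_ge0].
Qed.

Local Notation a := (overlap P f).

Lemma overlap_densityE i j : (a i j)%:E = \int[nu]_x (p i x * f j x)%:E.
Proof.
rewrite (overlapE P measurable_mean_ratio mean_ratio_ge0 mean_ratio_le).
rewrite integralPbar.
- apply: eq_integral => x _; rewrite -EFinM; congr (_%:E).
  by rewrite mulrAC ratioK.
- by apply/measurable_EFinP; apply: measurable_funM; exact: measurable_mean_ratio.
- by move=> x; rewrite lee_fin mulr_ge0 ?mean_ratio_ge0.
Qed.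

Let mpf i j : measurable_fun [set: T] (fun x => (p i x * f j x)%R).
Proof. by apply: measurable_funM => //; exact: measurable_mean_ratio. Qed.

Let pf0 i j x : (0 <= p i x * f j x)%R.
Proof. by rewrite mulr_ge0 ?mean_ratio_ge0. Qed.

Let integral_p i : \int[nu]_x (p i x)%:E = 1.
Proof. by rewrite -Pp// probability_setT. Qed.

Let overlap_row i : (\sum_j a i j = N%:R)%R.
Proof.
apply: EFin_inj; rewrite -sumEFin.
under eq_bigr do rewrite overlap_densityE.
rewrite -ge0_integral_sum//; last 2 first.
- by move=> j; exact/measurable_EFinP.
- by move=> j x _; rewrite lee_fin.
transitivity (\int[nu]_x (N%:R%:E * (p i x)%:E)).
  apply: eq_integral => x _; rewrite sumEFin -EFinM; congr (_%:E).
  rewrite -mulr_sumr /f -mulr_suml; have [e|e] := eqVneq (pbar x) 0%R.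
    by rewrite pbar_eq0// mul0r mulr0.
  have -> : (\sum_i p i x = N%:R * pbar x)%R.
    by rewrite /pbar mulrA mulfV ?gt_eqF// mul1r.
  by rewrite mulfK// mulrC.
rewrite ge0_integralZl_EFin//.
- by rewrite integral_p mule1.
- by move=> x _; rewrite lee_fin.
- exact/measurable_EFinP.
Qed.

Lemma chi2_densityE :
  chi2 (permuted_prod P) (iid_mean_prod P) = (mean_perm a - 1)%:E.
Proof.
apply: chi2_permutedE.
- exact: measurable_mean_ratio.
- exact: mean_ratio_ge0.
- exact: mean_ratio_le.
- exact: integral_mean_ratio.
Qed.

(** The trace of [A] in the overview, that is [1 + tr B]. *)
Definition mean_trace : R := ((\sum_i a i i) / N%:R)%R.

Let aC i j : a i j = a j i. Proof. exact: overlapC. Qed.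

Let apsd (x : 'I_N -> R) : (0 <= \sum_i \sum_j x i * a i j * x j)%R.
Proof.
apply: overlap_psd.
- exact: measurable_mean_ratio.
- exact: mean_ratio_ge0.
- exact: mean_ratio_le.
Qed.

Lemma chi2_le_trace tau : (tau < 1)%R -> (mean_trace <= 1 + tau)%R ->
  chi2 (permuted_prod P) (iid_mean_prod P) <= ((1 - tau)^-1 - 1)%:E.
Proof.
move=> t1 tr; rewrite chi2_densityE lee_fin lerD2r.
exact: mean_perm_le_trace.
Qed.

Lemma chi2_le_sqr tau : (0 <= tau <= 1 / 2)%R -> (mean_trace <= 1 + tau)%R ->
  chi2 (permuted_prod P) (iid_mean_prod P) <= (4 * tau ^+ 2)%:E.
Proof.
move=> t1 tr; rewrite chi2_densityE lee_fin.
exact: mean_perm_le_sqr.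
Qed.

Lemma chi2_le_expR tau L : (0 <= L)%R -> (mean_trace <= 1 + tau)%R ->
  (forall i j, expR (- L) <= a i j)%R ->
  chi2 (permuted_prod P) (iid_mean_prod P) <= (expR (2 * (1 + L) * tau) - 1)%:E.
Proof.
move=> L0 tr aL; rewrite chi2_densityE lee_fin lerD2r.
exact: mean_perm_le_expR.
Qed.

Let sum_overlapE : (\sum_i a i i)%:E = \int[nu]_x (\sum_i p i x * f i x)%:E.
Proof.
rewrite -sumEFin; under eq_bigr do rewrite overlap_densityE.
rewrite -ge0_integral_sum//; last 2 first.
- by move=> j; exact/measurable_EFinP.
- by move=> j x _; rewrite lee_fin.
by apply: eq_integral => x _; rewrite sumEFin.
Qed.

Lemma mean_trace_le (E : T -> R) (c : R) : measurable_fun [set: T] E ->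
  (forall x, \sum_i p i x * f i x <= N%:R * E x)%R ->
  \int[nu]_x (E x)%:E <= c%:E -> (mean_trace <= c)%R.
Proof.
move=> mE pE Ec; rewrite /mean_trace ler_pdivrMr// mulrC -lee_fin EFinM.
have E0 x : (0 <= E x)%R.
  rewrite -(pmulr_rge0 _ N0); apply: le_trans (pE x).
  exact: sumr_ge0.
rewrite sum_overlapE; apply: (@le_trans _ _ (N%:R%:E * \int[nu]_x (E x)%:E)).
  rewrite -ge0_integralZl_EFin//.
  - apply: ge0_le_integral => //.
    + by move=> x _; rewrite lee_fin sumr_ge0.
    + by apply/measurable_EFinP; apply: measurable_sum.
    + by apply: emeasurable_funM => //; exact/measurable_EFinP.
    + by move=> x _; rewrite -EFinM lee_fin.
  - by move=> x _; rewrite lee_fin.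
  - exact/measurable_EFinP.
by rewrite lee_wpmul2l// lee_fin.
Qed.

(** Replace each [p i] by [E] and use that the ratios [f i] add up to at most [N]. *)
Lemma mean_trace_le_envelope (E : T -> R) (c : R) : measurable_fun [set: T] E ->
  (forall i x, p i x <= E x)%R ->
  \int[nu]_x (E x)%:E <= c%:E -> (mean_trace <= c)%R.
Proof.
move=> mE pE; apply: mean_trace_le => // x.
have E0 : (0 <= E x)%R by apply: le_trans (pE ord0 x).
apply: (@le_trans _ _ (\sum_i E x * f i x)%R).
  by apply: ler_sum => i _; rewrite ler_wpM2r ?mean_ratio_ge0.
by rewrite -mulr_sumr mulrC ler_wpM2r// sum_mean_ratio_le.
Qed.

(* Convexity of [y |-> y^-1], through its tangent at [pbar x]. *)
Lemma mean_trace_le_pairwise (c : R) : (forall i x, 0 < p i x)%R ->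
  (forall i j, \int[nu]_x (p i x ^+ 2 / p j x)%:E <= c%:E) -> (mean_trace <= c)%R.
Proof.
move=> pgt0 H.
pose E x := (N%:R^-1 * (\sum_i (N%:R^-1 * \sum_j p i x ^+ 2 / p j x)))%R.
have mq i j : measurable_fun [set: T] (fun x => (p i x ^+ 2 / p j x)%R).
  by apply: measurable_funM; [exact: measurable_funX|exact: measurable_fun_inv].
have q0 i j x : (0 <= p i x ^+ 2 / p j x)%R by rewrite divr_ge0 ?sqr_ge0.
have mE1 i : measurable_fun [set: T] (fun x => N%:R^-1 * \sum_j p i x ^+ 2 / p j x)%R.
  by apply: measurable_funM => //; apply: measurable_sum.
have mE : measurable_fun [set: T] E.
  by apply: measurable_funM => //; apply: measurable_sum.
apply: (@mean_trace_le E) => // [x|].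
  rewrite /E mulrA mulfV ?gt_eqF// mul1r; apply: ler_sum => i _.
  have b0 : (0 < pbar x)%R.
    rewrite lt_neqAle pbar0 andbT eq_sym; apply/eqP => /(pbar_eq0 i) e.
    by have := pgt0 i x; rewrite e ltxx.
  rewrite /f mulrA -expr2 -mulr_sumr mulrCA ler_wpM2l ?sqr_ge0//.
  have S : (\sum_j ((pbar x)^-1 + (pbar x)^-1 - p j x / pbar x ^+ 2) <=
      \sum_j (p j x)^-1)%R.
    apply: ler_sum => j _; have pj := pgt0 j x.
    rewrite -subr_ge0.
    have -> : ((p j x)^-1 - ((pbar x)^-1 + (pbar x)^-1 - p j x / pbar x ^+ 2) =
      (p j x - pbar x) ^+ 2 / (p j x * pbar x ^+ 2))%R.
      by field; rewrite !gt_eqF.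
    by rewrite divr_ge0 ?sqr_ge0// mulr_ge0 ?sqr_ge0.
  have sp : (\sum_i p i x = N%:R * pbar x)%R.
    by rewrite /pbar mulrA mulfV ?gt_eqF// mul1r.
  rewrite ler_pdivlMl//; apply: le_trans S.
  rewrite sumrB sumr_const card_ord -mulr_suml sp le_eqVlt.
  apply/orP; left; apply/eqP.
  rewrite -[(((pbar x)^-1 + _) *+ _)%R]mulr_natl; field.
  by rewrite gt_eqF.
rewrite /E; under eq_integral do rewrite EFinM.
rewrite ge0_integralZl_EFin//; last 2 first.
- by move=> x _; rewrite lee_fin sumr_ge0// => i _; rewrite mulr_ge0 ?invr_ge0 ?sumr_ge0.
- by apply/measurable_EFinP; apply: measurable_sum.
under eq_integral do rewrite -sumEFin.
rewrite ge0_integral_sum//; last 2 first.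
- by move=> i; exact/measurable_EFinP.
- by move=> i x _; rewrite lee_fin mulr_ge0 ?invr_ge0 ?sumr_ge0.
have step i : \int[nu]_x (N%:R^-1 * \sum_j p i x ^+ 2 / p j x)%:E <= c%:E.
  under eq_integral do rewrite EFinM.
  rewrite ge0_integralZl_EFin//; last 2 first.
  - by move=> x _; rewrite lee_fin sumr_ge0.
  - by apply/measurable_EFinP; apply: measurable_sum.
  under eq_integral do rewrite -sumEFin.
  rewrite ge0_integral_sum//; last 2 first.
  - by move=> j; exact/measurable_EFinP.
  - by move=> j x _; rewrite lee_fin.
  apply: (@le_trans _ _ ((N%:R^-1)%:E * \sum_(j < N) c%:E)).
    apply: lee_wpmul2l; first by rewrite lee_fin invr_ge0 ltW.
  by apply: lee_sum => j _.
  rewrite sumEFin -EFinM lee_fin sumr_const card_ord -[(c *+ _)%R]mulr_natl.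
  by rewrite mulrA mulVf ?gt_eqF// mul1r.
apply: (@le_trans _ _ ((N%:R^-1)%:E * \sum_(j < N) c%:E)).
  apply: lee_wpmul2l; first by rewrite lee_fin invr_ge0 ltW.
  by apply: lee_sum => j _.
rewrite sumEFin -EFinM lee_fin sumr_const card_ord -[(c *+ _)%R]mulr_natl.
by rewrite mulrA mulVf ?gt_eqF// mul1r.
Qed.

(* Pointwise, [p i * p j / pbar >= 2 * H * h - H ^+ 2 * pbar]. *)
Lemma overlap_ge i j (h : T -> R) (H : R) : measurable_fun [set: T] h ->
  (forall x, 0 <= h x)%R -> (forall x, h x ^+ 2 <= p i x * p j x)%R ->
  (0 <= H)%R -> H%:E <= \int[nu]_x (h x)%:E -> (H ^+ 2 <= a i j)%R.
Proof.
move=> mh h0 hp H0 Hh.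
have key : (2 * H)%:E * \int[nu]_x (h x)%:E <= (a i j)%:E + (H ^+ 2)%:E.
  have int_pbar : \int[nu]_x (pbar x)%:E = 1.
    have := @integralPbar (cst 1) (measurable_cst _) (fun=> lee01).
    under eq_integral do rewrite mul1e.
    move=> <-; rewrite integral_cst// mul1e.
    exact: (probability_setT Pbar).
  rewrite overlap_densityE -[X in _ + X]mule1 -int_pbar.
  rewrite -!ge0_integralZl_EFin ?mulr_ge0 ?sqr_ge0//; first last.
  - exact/measurable_EFinP.
  - by move=> x _; rewrite lee_fin.
  - exact/measurable_EFinP.
  - by move=> x _; rewrite lee_fin.
  rewrite -ge0_integralD//; first last.
  - by apply: emeasurable_funM => //; exact/measurable_EFinP.
  - by move=> x _; rewrite -EFinM lee_fin mulr_ge0 ?sqr_ge0.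
  - exact/measurable_EFinP.
  - by move=> x _; rewrite lee_fin.
  apply: ge0_le_integral => //.
  - by move=> x _; rewrite -EFinM lee_fin !mulr_ge0.
  - by apply: emeasurable_funM => //; exact/measurable_EFinP.
  - apply: emeasurable_funD; first exact/measurable_EFinP.
    by apply: emeasurable_funM => //; exact/measurable_EFinP.
  move=> x _; rewrite -!EFinM -EFinD lee_fin.
  have hx := hp x; have hx0 := h0 x.
  have [e|e] := eqVneq (pbar x) 0%R.
    move: hx; rewrite (pbar_eq0 i e) mul0r => hx.
    have -> : h x = 0%R.
      by apply/eqP; rewrite -sqrf_eq0 eq_le hx sqr_ge0.
    by rewrite e mul0r !mulr0 addr0.
  have b0 : (0 < pbar x)%R by rewrite lt_neqAle eq_sym e pbar0.
  rewrite /f mulrA -subr_ge0.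
  have -> : (p i x * p j x / pbar x + H ^+ 2 * pbar x - 2 * H * h x =
    ((p i x * p j x - h x ^+ 2) + (h x - H * pbar x) ^+ 2) / pbar x)%R.
    by field; rewrite gt_eqF.
  apply: divr_ge0; last exact: ltW.
  by rewrite addr_ge0 ?sqr_ge0// subr_ge0.
have : (2 * H)%:E * H%:E <= (a i j)%:E + (H ^+ 2)%:E.
  apply: le_trans key; apply: lee_wpmul2l => //.
  by rewrite lee_fin mulr_ge0.
rewrite -EFinM -EFinD lee_fin; nra.
Qed.

End density_bounds.

(** * The Gaussian, Bernoulli and Poisson families *)

Section gaussian.
Context {R : realType}.
Local Notation mu := (@lebesgue_measure R).
Local Notation pdf := (fun m x : R => normal_pdf m 1 x).

Lemma normal_pdf1E (m x : R) :
  normal_pdf m 1 x = normal_peak 1 * expR (- (x - m) ^+ 2 / 2).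
Proof.
by rewrite normal_pdfE ?oner_neq0// /normal_fun expr1n.
Qed.

Lemma normal_peak1_le1 : normal_peak 1 <= 1 :> R.
Proof.
rewrite /normal_peak expr1n mul1r invf_le1 ?sqrtr_gt0.
  rewrite -[leLHS]sqrtr1 ler_sqrt; have := @pi_ge2 R; lra.
have := @pi_gt0 R; lra.
Qed.

Lemma normal_peak1_gt0 : 0 < normal_peak 1 :> R.
Proof. exact: normal_peak_gt0 (oner_neq0 _). Qed.

(** Completing the square; integrating, one plus the chi-square divergence between the two laws is
    [expR ((a - b) ^+ 2)]. *)
Lemma normal_pdf_sqr_div (a b x : R) : normal_pdf a 1 x ^+ 2 / normal_pdf b 1 x =
  expR ((a - b) ^+ 2) * normal_pdf (2 * a - b) 1 x.
Proof.
rewrite !normal_pdf1E; have k0 := normal_peak1_gt0.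
have e0 : 0 < expR (- (x - b) ^+ 2 / 2) by exact: expR_gt0.
have E : expR (- (x - a) ^+ 2 / 2) ^+ 2 = expR ((a - b) ^+ 2) *
    expR (- (x - (2 * a - b)) ^+ 2 / 2) * expR (- (x - b) ^+ 2 / 2).
  by rewrite -expRM_natl -!expRD; congr expR; field.
by rewrite exprMn E; field; rewrite !gt_eqF.
Qed.

(** The geometric mean of two Gaussian densities is a multiple of the Gaussian density at the
    midpoint, the multiple being the Hellinger affinity. *)
Lemma normal_pdf_mid (a b x : R) :
  (expR (- (a - b) ^+ 2 / 8) * normal_pdf ((a + b) / 2) 1 x) ^+ 2 =
  normal_pdf a 1 x * normal_pdf b 1 x.
Proof.
rewrite !normal_pdf1E mulrACA -expRD mulrCA -expRD exprMn -expRM_natl expr2.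
by congr (_ * expR _); field.
Qed.

Lemma integral_scale_normal_pdf (c m : R) : 0 <= c ->
  (\int[mu]_x (c * normal_pdf m 1 x)%:E = c%:E)%E.
Proof.
move=> c0; under eq_integral do rewrite EFinM.
rewrite ge0_integralZl_EFin//.
- by rewrite integral_normal_pdf mule1.
- by move=> x _; rewrite lee_fin normal_pdf_ge0.
- by apply/measurable_EFinP; exact: measurable_normal_pdf.
Qed.

Section sample.
Variables (n : nat)
  (P : 'I_n.+1 -> probability (g_sigma_algebraType (R.-ocitv.-measurable)) R)
  (th : 'I_n.+1 -> R) (m : R).
Hypothesis thm : forall i, `|th i| <= m.
Hypothesis PE : forall i, P i = gaussian (th i).

Let p i x := normal_pdf (th i) 1 x.

Let mp i : measurable_fun [set: R] (p i). Proof. exact: measurable_normal_pdf. Qed.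
Let p0 i x : 0 <= p i x. Proof. exact: normal_pdf_ge0. Qed.
Let Pp i A : measurable A -> (P i A = \int[mu]_(x in A) (p i x)%:E)%E.
Proof. by move=> _; rewrite PE. Qed.
Let m0 : 0 <= m. Proof. exact: le_trans (normr_ge0 _) (thm ord0). Qed.
Let dist2 i j : (th i - th j) ^+ 2 <= 4 * m ^+ 2.
Proof.
have : `|th i - th j| <= 2 * m.
  by apply: (le_trans (ler_normB _ _)); have := thm i; have := thm j; lra.
rewrite -real_normK ?num_real// => h; have := normr_ge0 (th i - th j); nra.
Qed.

Lemma gaussian_chi2_small : m <= 1 / 4 ->
  (chi2 (permuted_prod P) (iid_mean_prod P) <= (144 * m ^+ 4)%:E)%E.
Proof.
move=> m4.
(* Pairwise divergences are at most [expR (4 * m ^+ 2) - 1], hence [tau = 6 * m ^+ 2]. *)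
have -> : 144 * m ^+ 4 = 4 * (6 * m ^+ 2) ^+ 2 by ring.
have m2 : m ^+ 2 <= 1 / 16 by have := m0; nra.
have m20 := sqr_ge0 m.
apply: (chi2_le_sqr (nu := mu) (p := p)) => //; first by apply/andP; split; lra.
have eE : expR (4 * m ^+ 2) <= 1 + 6 * m ^+ 2.
  have := expR_ge1Dx (- (4 * m ^+ 2)); rewrite expRN => h.
  have := expR_gt0 (4 * m ^+ 2); set e := expR _ in h * => e0.
  have : e * (1 - 4 * m ^+ 2) <= 1.
    by have := ler_wpM2l (ltW e0) h; rewrite mulfV ?gt_eqF.
  nra.
apply: (mean_trace_le_pairwise (nu := mu)) => // [i x|i j].
  by rewrite /p normal_pdf1E mulr_gt0 ?expR_gt0 ?normal_peak1_gt0.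
rewrite /p; under eq_integral do rewrite normal_pdf_sqr_div.
rewrite integral_scale_normal_pdf ?expR_ge0// lee_fin (le_trans _ eE)//.
by rewrite ler_expR.
Qed.

Let overlap_gauss i j : expR (- m ^+ 2) <= overlap P (mean_ratio p) i j.
Proof.
pose H := expR (- (th i - th j) ^+ 2 / 8).
apply: (@le_trans _ _ (H ^+ 2)).
  rewrite /H -expRM_natl ler_expR; have := dist2 i j; lra.
apply: (@overlap_ge _ _ R mu n P p mp p0 Pp i j
  (fun x => H * normal_pdf ((th i + th j) / 2) 1 x)).
- by apply: measurable_funM => //; exact: measurable_normal_pdf.
- by move=> x; rewrite mulr_ge0 ?expR_ge0 ?normal_pdf_ge0.
- by move=> x; rewrite normal_pdf_mid.
- exact: expR_ge0.
- by rewrite integral_scale_normal_pdf ?expR_ge0.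
Qed.

Let gaussian_chi2_envelope (E : R -> R) (tau C : R) : 1 / 4 < m ->
  measurable_fun [set: R] E -> (forall i x, p i x <= E x) ->
  (\int[mu]_x (E x)%:E <= (1 + tau)%:E)%E ->
  0 <= tau -> 34 * m ^+ 2 * tau <= C ->
  (chi2 (permuted_prod P) (iid_mean_prod P) <= (expR C - 1)%:E)%E.
Proof.
move=> m4 mE pE HE tau0 tC.
have := @chi2_le_expR _ _ R mu n P p mp p0 Pp tau (m ^+ 2) (sqr_ge0 _).
move=> /(_ (@mean_trace_le_envelope _ _ R mu n P p mp p0 Pp E (1 + tau) mE pE HE)).
move=> /(_ overlap_gauss) h.
apply: (le_trans h); rewrite lee_fin lerD2r ler_expR; apply: le_trans tC.
(* [2 * (1 + m ^+ 2) <= 34 * m ^+ 2] because [m ^+ 2] exceeds 1/16. *)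
apply: ler_wpM2r => //; nra.
Qed.

Lemma gaussian_chi2_large : 1 / 4 < m ->
  (chi2 (permuted_prod P) (iid_mean_prod P) <= (expR (204 * m ^+ 3) - 1)%:E)%E.
Proof.
move=> m4.
pose I x : R := normal_peak 1 * \1_(`[- m, m] : set R) x.
(* The peak value on [[- m, m]], and outside it the density centred at the nearer endpoint. The
   total mass is at most [2 * m + 2]. *)
pose E x := I x + (1 * normal_pdf m 1 x + 1 * normal_pdf (- m) 1 x).
have k0 := normal_peak1_gt0.
have mI : measurable_fun [set: R] I by exact: measurable_funM.
have I0 x : 0 <= I x by rewrite mulr_ge0// ltW.
have mq a : measurable_fun [set: R] (fun x : R => 1 * normal_pdf a 1 x).
  by apply: measurable_funM => //; exact: measurable_normal_pdf.
have q0 a (x : R) : 0 <= 1 * normal_pdf a 1 x by rewrite mul1r normal_pdf_ge0.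
have mqq : measurable_fun [set: R]
    (fun x : R => 1 * normal_pdf m 1 x + 1 * normal_pdf (- m) 1 x).
  exact: measurable_funD.
apply: (@gaussian_chi2_envelope E (2 * m + 1)) => //.
- exact: measurable_funD.
- move=> i x; have := I0 x; rewrite /E /I !mul1r indicE => I0x.
  have qm a : 0 <= normal_pdf a 1 x by exact: normal_pdf_ge0.
  have := thm i; rewrite ler_norml => /andP[t1 t2].
  have [xm|xm] := leP x m; last first.
    have : p i x <= normal_pdf m 1 x.
      by rewrite /p !normal_pdf1E ler_pM2l// ler_expR; nra.
    by have := qm (- m); lra.
  have [mx|mx] := leP (- m) x; last first.
    have : p i x <= normal_pdf (- m) 1 x.
      by rewrite /p !normal_pdf1E ler_pM2l// ler_expR; nra.
    by have := qm m; lra.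
  rewrite mem_set; last by rewrite /= in_itv/= mx xm.
  rewrite mulr1; have := normal_pdf_ub (th i) x (oner_neq0 R).
  by rewrite -/(p i x); have := qm m; have := qm (- m); lra.
- rewrite /E; under eq_integral do rewrite EFinD.
  rewrite ge0_integralD//; last 4 first.
  + by move=> x _; rewrite lee_fin.
  + exact/measurable_EFinP.
  + by move=> x _; rewrite lee_fin addr_ge0.
  + exact/measurable_EFinP.
  under [X in (_ + X)%E]eq_integral do rewrite EFinD.
  rewrite ge0_integralD//; last 4 first.
  + by move=> x _; rewrite lee_fin.
  + by apply/measurable_EFinP; exact: mq.
  + by move=> x _; rewrite lee_fin.
  + by apply/measurable_EFinP; exact: mq.
  rewrite !integral_scale_normal_pdf// /I.
  under eq_integral do rewrite EFinM.
  rewrite ge0_integralZl_EFin//; last 2 first.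
  + exact/measurable_EFinP.
  + exact: ltW.
  have len : lebesgue_measure (`[- m, m]%classic : set R) = (2 * m)%:E.
    rewrite lebesgue_measure_itv/= lte_fin ifT; last by have := m0; lra.
    by rewrite -EFinB; congr (_%:E); ring.
  rewrite integral_indic// setIT [X in (_ * X + _)%E]len.
  rewrite -EFinM -!EFinD lee_fin.
  have := normal_peak1_le1; have := m0; nra.
- by have := m0; lra.
- have : 0 < m by lra.
  move=> m0'; have -> : 204 * m ^+ 3 = 34 * m ^+ 2 * (6 * m) by ring.
  rewrite ler_wpM2l ?mulr_ge0 ?sqr_ge0//; lra.
Qed.

Lemma gaussian_chi2_finite (Theta : {fset R}) : (forall i, th i \in Theta) ->
  1 / 4 < m ->
  (chi2 (permuted_prod P) (iid_mean_prod P) <=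
   (expR (34 * (#|` Theta|%:R * m ^+ 2)) - 1)%:E)%E.
Proof.
move=> thT m4.
apply: (@gaussian_chi2_envelope (fun x => \sum_(t <- Theta) normal_pdf t 1 x)
  #|` Theta|%:R) => //.
- by apply: measurable_sum => t; exact: measurable_normal_pdf.
- move=> i x; rewrite (bigD1_seq (th i)) ?thT ?fset_uniq//= lerDl.
  by apply: sumr_ge0 => t _; exact: normal_pdf_ge0.
- under eq_integral do rewrite -sumEFin.
  rewrite ge0_integral_sum//; last 2 first.
  + by move=> t; apply/measurable_EFinP; exact: measurable_normal_pdf.
  + by move=> t x _; rewrite lee_fin normal_pdf_ge0.
  under eq_bigr do rewrite integral_normal_pdf.
  rewrite sumEFin lee_fin big_const_seq count_predT iter_addr_0.
  by rewrite lerDr.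
- by rewrite -mulrA [m ^+ 2 * _]mulrC.
Qed.

End sample.
End gaussian.

(** * Bernoulli family *)

Section bernoulli.
Context {R : realType}.
Variables (n : nat) (P : 'I_n.+1 -> probability bool R) (q : 'I_n.+1 -> R) (e : R).
Hypothesis qe : forall i, e <= q i <= 1 - e.
Hypothesis e01 : 0 < e <= 1 / 2.
Hypothesis PE : forall i, P i = bern (q i).

Let nu : probability bool R := bern (1 / 2).
Let p i (b : bool) : R := 2 * (if b then q i else 1 - q i).

Let q01 i : 0 <= q i <= 1.
Proof. by have /andP[] := qe i; move/andP: e01 => [? ?] ? ?; apply/andP; split; lra. Qed.

Let mp i : measurable_fun [set: bool] (p i). Proof. by []. Qed.

Let p0 i b : 0 <= p i b.
Proof. by have /andP[? ?] := q01 i; rewrite /p; case: b; lra. Qed.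

Let int_nu (f : bool -> R) : (forall b, 0 <= f b) ->
  (\int[nu]_b (f b)%:E = ((f true + f false) / 2)%:E)%E.
Proof.
move=> f0; rewrite /nu /bern integral_bernoulli_prob.
- by rewrite /unstable.onem -!EFinM -EFinD; congr (_%:E); by field.
- by apply/andP; split; lra.
- by move=> b; rewrite lee_fin.
Qed.

Let Pp i A : measurable A -> (P i A = \int[nu]_(x in A) (p i x)%:E)%E.
Proof.
move=> mA; rewrite PE /bern /= bernoulli_probE ?q01//.
rewrite integral_mkcond.
have -> : ((fun x => (p i x)%:E) \_ A)%E = (fun b => (p i b * \1_A b)%:E).
  by apply/funext => b; rewrite epatch_indic EFinM.
rewrite int_nu; last by move=> b; rewrite mulr_ge0.
rewrite !diracE !indicE /p /unstable.onem -!EFinM -EFinD; congr (_%:E); by field.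
Qed.

(** The constant envelope [2 * (1 - e)] gives [tau = 1 - 2 * e < 1], and [(1 - tau)^-1] is
    [1 / (2 * e)]. *)
Lemma bernoulli_chi2_large :
  (chi2 (permuted_prod P) (iid_mean_prod P) <= (1 * (1 / e))%:E)%E.
Proof.
have /andP[e0 e1] := e01.
apply: (@le_trans _ _ ((1 - (1 - 2 * e))^-1 - 1)%:E).
  apply: (chi2_le_trace (nu := nu) (p := p)) => //; first by lra.
  apply: (@mean_trace_le_envelope _ _ R nu n P p mp p0 Pp (cst (2 * (1 - e)))) => //.
    move=> i b; have /andP[? ?] := qe i; rewrite /p /=; case: b; lra.
  rewrite int_nu => [|b]; last by rewrite /=; lra.
  by rewrite lee_fin /=; lra.
rewrite lee_fin mul1r div1r.
have -> : 1 - (1 - 2 * e) = 2 * e by ring.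
rewrite invfM; have : 0 < e^-1 by rewrite invr_gt0.
lra.
Qed.

Lemma bernoulli_chi2_small : 3 / 8 <= e ->
  (chi2 (permuted_prod P) (iid_mean_prod P) <= (100 * (1 - 2 * e) ^+ 4)%:E)%E.
Proof.
move=> e3; have /andP[e0 e1] := e01.
have -> : 100 * (1 - 2 * e) ^+ 4 = 4 * (5 * (1 - 2 * e) ^+ 2) ^+ 2 by ring.
apply: (chi2_le_sqr (nu := nu) (p := p)) => //.
  by apply/andP; split; [have := sqr_ge0 (1 - 2 * e); lra|nra].
have qgt0 i : 0 < q i < 1.
  by have /andP[? ?] := qe i; apply/andP; split; lra.
apply: (mean_trace_le_pairwise (nu := nu)) => // [i b|i j].
  by have /andP[? ?] := qgt0 i; rewrite /p; case: b; lra.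
rewrite int_nu => [|b]; last by rewrite divr_ge0 ?sqr_ge0.
rewrite lee_fin /p.
have /andP[i1 i2] := qe i; have /andP[j1 j2] := qe j.
have /andP[j3 j4] := qgt0 j.
have -> : ((2 * q i) ^+ 2 / (2 * q j) + (2 * (1 - q i)) ^+ 2 / (2 * (1 - q j))) / 2 =
    1 + (q i - q j) ^+ 2 / (q j * (1 - q j)).
  by field; rewrite !gt_eqF//; lra.
rewrite lerD2l ler_pdivrMr; last by rewrite mulr_gt0//; lra.
have h1 : (q i - q j) ^+ 2 <= (1 - 2 * e) ^+ 2 by nra.
(* [q j] lies in [[3/8, 5/8]], so the variance is at least 15/64; this is the source of the 5 in
   [tau]. *)
have h2 : 1 <= 5 * (q j * (1 - q j)) by nra.
have := sqr_ge0 (1 - 2 * e); nra.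
Qed.

End bernoulli.

(** * A Stirling bound for the Poisson modes *)

Section stirling.
Context {R : realType}.

Lemma expR_sub_ge (t : R) : 0 <= t -> 2 * t <= expR t - expR (- t).
Proof.
move=> t0; pose g (x : R) := 2 * x - expR x + expR (- x).
have dg (x : R) : is_derive x 1 g (2 - expR x - expR (- x)).
  have de : is_derive x 1 (fun x : R => expR (- x)) (- expR (- x)).
    apply: is_derive_eq; rewrite /GRing.scale/=; ring.
  apply: is_derive_eq; rewrite /GRing.scale/=; ring.
have gdec : g t <= g 0.
  apply: (@ler0_derive1_nincry _ g 0) => //.
  - move=> y _; rewrite derive1E derive_val.
    have e0 := expR_gt0 y.
    have : expR y * expR (- y) = 1 by rewrite expRN mulfV ?gt_eqF.
    set u := expR y in e0 *; set v := expR (- y) => uv.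
    have := sqr_ge0 (u - 1); nra.
  - apply: continuous_subspaceT => y.
    by apply/differentiable_continuous/derivable1_diffP; have [h _] := dg y; exact: h.
by move: gdec; rewrite /g oppr0 expR0; lra.
Qed.

(** The inequality [2 * t <= expR t - expR (- t)] at [t = ln s]. *)
Lemma le_expR_sub_inv (s : R) : 1 <= s -> s ^+ 2 <= expR (s - s^-1).
Proof.
move=> s1; have s0 : 0 < s by lra.
have := @expR_sub_ge (ln s) (ln_ge0 s1).
rewrite expRN lnK ?posrE// => h.
by rewrite -[s in s ^+ 2](lnK s0) -expRM_natl ler_expR.
Qed.

(** The Poisson mass at [k] maximized over the rate, the maximum being at rate [k]. *)
Definition max_poisson (k : nat) : R := k%:R ^+ k * expR (- k%:R) / k`!%:R.

(* The ratio of consecutive terms of [max_poisson k * sqrt (k + 1)] is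
   [(1 + 1/k) ^ k * sqrt (1 + 1/(k+1)) / e], and [ln (1 + 1/k) <= s - 1/s] for
   [s = sqrt (1 + 1/k)], where [1/s = sqrt (1 - 1/(k+1)) <= 1 - 1/(2(k+1))]. *)
Lemma max_poisson_le (k : nat) : max_poisson k * Num.sqrt k.+1%:R <= 1.
Proof.
elim: k => [|k IH].
  by rewrite /max_poisson expr0 oppr0 expR0 fact0 divr1 !mul1r sqrtr1.
have [->|k0] := posnP k.
  rewrite /max_poisson expr1 divr1 !mul1r.
  have h1 : expR (- 1) <= 1 / 2 :> R.
    rewrite expRN div1r lef_pV2 ?posrE ?expR_gt0//.
    by have := expR_ge1Dx (1 : R); lra.
  have h2 : Num.sqrt 2 <= 2 :> R.
    by rewrite -[leRHS]ger0_norm// -sqrtr_sqr ler_sqrt; lra.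
  have := expR_gt0 (- 1 : R); have := sqrtr_ge0 (2 : R); nra.
apply: le_trans IH.
have kR : 0 < k%:R :> R by rewrite ltr0n.
have k1R : 0 < k.+1%:R :> R by rewrite ltr0n.
have k1E : k.+1%:R = k%:R + 1 :> R by rewrite -natr1.
pose u : R := k.+1%:R^-1.
have u0 : 0 < u by rewrite invr_gt0.
have uk : u * k.+1%:R = 1 by rewrite mulVf// gt_eqF.
pose s : R := Num.sqrt (k.+1%:R / k%:R).
have s2 : s ^+ 2 = k.+1%:R / k%:R by rewrite sqr_sqrtr// divr_ge0// ltW.
have s1 : 1 <= s.
  by rewrite -[leLHS]sqrtr1 ler_sqrt ?divr_gt0// ler_pdivlMr// mul1r k1E lerDl.
have sV0 : 0 < s^-1 by rewrite invr_gt0; lra.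
have sV : s^-1 <= 1 - u / 2.
  have : s^-1 ^+ 2 = 1 - u.
    by rewrite exprVn s2 /u invf_div k1E; field; rewrite gt_eqF//; lra.
  have : u <= 1 by rewrite /u invf_le1// ler1n.
  by nra.
have h1 : (k.+1%:R / k%:R) ^+ k <= expR (1 - u / 2).
  rewrite -s2; apply: (@le_trans _ _ (expR (s - s^-1) ^+ k)).
    by rewrite lerXn2r ?nnegrE ?sqr_ge0 ?expR_ge0// le_expR_sub_inv.
  rewrite -expRM_natl ler_expR; apply: le_trans sV.
  have -> : s - s^-1 = (s ^+ 2 - 1) * s^-1 by field; lra.
  rewrite s2 k1E mulrA; have -> : k%:R * ((k%:R + 1) / k%:R - 1) = 1 :> R.
    by field; rewrite gt_eqF.
  by rewrite mul1r.
have h2 : Num.sqrt k.+2%:R <= expR (u / 2) * Num.sqrt k.+1%:R.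
  have -> : expR (u / 2) = Num.sqrt (expR u).
    by rewrite {2}(_ : u = 2%:R * (u / 2)) ?expRM_natl ?sqrtr_sqr ?ger0_norm ?expR_ge0//; lra.
  rewrite -sqrtrM ?expR_ge0// ler_sqrt ?mulr_gt0 ?expR_gt0//.
  have -> : k.+2%:R = (1 + u) * k.+1%:R :> R.
    by rewrite mulrDl uk -natr1; ring.
  by rewrite ler_pM2r// expR_ge1Dx.
have h3 : max_poisson k.+1 = max_poisson k * ((k.+1%:R / k%:R) ^+ k * expR (- 1)).
  rewrite /max_poisson factS natrM exprS expr_div_n k1E opprD expRD.
  have kk : k%:R ^+ k != 0 :> R by rewrite expf_neq0// gt_eqF.
  field; rewrite kk pnatr_eq0 -lt0n fact_gt0/= gt_eqF//; lra.
have c0 : 0 <= max_poisson k.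
  by rewrite /max_poisson divr_ge0// mulr_ge0 ?expR_ge0// exprn_ge0.
rewrite h3; move: (max_poisson k) c0 => c c0; rewrite -!mulrA ler_wpM2l//.
apply: (@le_trans _ _ (expR (1 - u / 2) *
  (expR (- 1) * (expR (u / 2) * Num.sqrt k.+1%:R)))).
  have q0 : 0 <= (k.+1%:R / k%:R) ^+ k :> R.
    by apply: exprn_ge0; apply: divr_ge0; exact: ltW.
  have r0 : 0 <= expR (- 1) * Num.sqrt k.+2%:R :> R.
    by rewrite mulr_ge0 ?expR_ge0 ?sqrtr_ge0.
  by apply: ler_pM => //; rewrite ler_wpM2l ?expR_ge0.
rewrite !mulrA -!expRD.
have -> : 1 - u / 2 + - 1 + u / 2 = 0 by ring.
by rewrite expR0 mul1r.
Qed.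

End stirling.

(** * Poisson family *)

Section poisson.
Context {R : realType}.
Local Notation nu := (@counting nat R).

Definition poisson_density (l : R) (k : nat) : R := l ^+ k / k`!%:R * expR (- l).

Lemma poisson_density_ge0 l k : 0 <= l -> 0 <= poisson_density l k.
Proof. by move=> l0; rewrite mulr_ge0 ?expR_ge0// divr_ge0// exprn_ge0. Qed.

Lemma integral_exp_coeff (c x : R) : 0 <= c -> 0 <= x ->
  (\int[nu]_k (c * (x ^+ k / k`!%:R))%:E = (c * expR x)%:E)%E.
Proof.
move=> c0 x0; have e0 k : 0 <= x ^+ k / k`!%:R by rewrite divr_ge0// exprn_ge0.
rewrite ge0_integral_count => [|k]; last by rewrite lee_fin mulr_ge0.
under eq_eseriesr do rewrite EFinM.
rewrite nneseriesZl//=; last by move=> n _; rewrite lee_fin.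
rewrite EFinM; congr (_ * _)%E; rewrite -EFin_lim; last first.
  exact: is_cvg_series_exp_coeff.
apply/congr_lim/funext => n/=; rewrite /series/= -sumEFin//.
Qed.

(** At [l = 0] the law is the Dirac mass at 0, which the density reproduces through [0 ^+ 0 = 1]. *)
Lemma poi_density (l : R) (A : set nat) : 0 <= l ->
  (poi l A = \int[nu]_(k in A) (poisson_density l k)%:E)%E.
Proof.
move=> l0; rewrite integral_mkcond.
have -> : ((fun k => (poisson_density l k)%:E) \_ A)%E =
    (fun k => (poisson_density l k * \1_A k)%:E).
  by apply/funext => k; rewrite epatch_indic EFinM.
have h0 k : 0 <= poisson_density l k * \1_A k by rewrite mulr_ge0// poisson_density_ge0.
rewrite ge0_integral_count => [|k]; last by rewrite lee_fin.
rewrite nneseries_esumT => [|k]; last by rewrite lee_fin.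
rewrite /poi/= /poisson_prob; case: ifPn => [lpos|].
  rewrite esum_mkcond; apply: eq_esum => k _; rewrite indicE.
  case: (k \in A); last by rewrite mulr0.
  by rewrite mulr1 /poisson_pmf lpos.
rewrite -leNgt => l0'; have -> : l = 0 by apply/eqP; rewrite eq_le l0' l0.
rewrite -nneseries_esumT; last first.
  move=> k; rewrite lee_fin mulr_ge0// poisson_density_ge0//.
rewrite (nneseries_split 0 1)//; last first.
  by move=> k _; rewrite lee_fin mulr_ge0// poisson_density_ge0.
rewrite add0n big_nat1 eseries0 => [|k k1 _].
  rewrite adde0 /poisson_density expr0 fact0 divr1 oppr0 expR0 !mul1r.
  by rewrite diracE indicE.
by rewrite /poisson_density expr0n gtn_eqF// !mul0r.
Qed.

Section sample.
Variables (n : nat) (P : 'I_n.+1 -> probability nat R) (l : 'I_n.+1 -> R) (M : R).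
Hypothesis lM : forall i, 0 <= l i <= M.
Hypothesis PE : forall i, P i = poi (l i).

Let p i k := poisson_density (l i) k.

Let mp i : measurable_fun [set: nat] (p i). Proof. by []. Qed.
Let p0 i k : 0 <= p i k.
Proof. by apply: poisson_density_ge0; have /andP[] := lM i. Qed.
Let Pp i A : measurable A -> (P i A = \int[nu]_(x in A) (p i x)%:E)%E.
Proof. by move=> _; rewrite PE poi_density//; have /andP[] := lM i. Qed.
Let M0 : 0 <= M. Proof. by have /andP[a b] := lM ord0; exact: le_trans a b. Qed.

Let trace_exp : mean_trace P p <= expR M.
Proof.
apply: (@mean_trace_le_envelope _ _ R nu n P p mp p0 Pp
  (fun k => 1 * (M ^+ k / k`!%:R))) => //.
  move=> i k; have /andP[a b] := lM i.
  rewrite mul1r /p /poisson_density; apply: (@le_trans _ _ (l i ^+ k / k`!%:R)).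
    rewrite ler_piMr ?divr_ge0 ?exprn_ge0//.
    by rewrite -expR0 ler_expR oppr_le0.
  by rewrite ler_wpM2r ?invr_ge0// lerXn2r.
by rewrite integral_exp_coeff// mul1r.
Qed.

(** [H] is the Hellinger affinity. Since [g] is at least the smaller rate, [a + b - 2 * g <= M]. *)
Let overlap_poisson i j : expR (- M) <= overlap P (mean_ratio p) i j.
Proof.
have /andP[a0 aM] := lM i; have /andP[b0 bM] := lM j.
set a := l i in a0 aM; set b := l j in b0 bM.
pose g := Num.sqrt (a * b).
have g0 : 0 <= g by exact: sqrtr_ge0.
have g2 : g ^+ 2 = a * b by rewrite sqr_sqrtr// mulr_ge0.
pose H := expR (- ((a + b) / 2)) * expR g.
apply: (@le_trans _ _ (H ^+ 2)).
  rewrite /H -expRD -expRM_natl ler_expR.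
  have [ab|ba] := leP a b.
    have : a <= g by rewrite -ler_sqr ?nnegrE// g2 expr2; nra.
    lra.
  have : b <= g by rewrite -ler_sqr ?nnegrE// g2 expr2; nra.
  lra.
apply: (@overlap_ge _ _ R nu n P p mp p0 Pp i j
  (fun k => expR (- ((a + b) / 2)) * (g ^+ k / k`!%:R))) => //.
- by move=> k; rewrite mulr_ge0 ?expR_ge0// divr_ge0// exprn_ge0.
- move=> k; rewrite /p /poisson_density -/a -/b le_eqVlt; apply/orP; left; apply/eqP.
  rewrite exprMn -expRM_natl.
  have -> : 2%:R * - ((a + b) / 2) = - a + - b by field.
  rewrite expRD expr_div_n -exprM mulnC exprM g2 exprMn.
  by field; rewrite pnatr_eq0 -lt0n fact_gt0.
- by rewrite mulr_ge0 ?expR_ge0.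
- by rewrite integral_exp_coeff ?expR_ge0.
Qed.

Lemma poisson_chi2_small : M <= 1 ->
  (chi2 (permuted_prod P) (iid_mean_prod P) <=
    (16 * expR (4 * expR 1) * M ^+ 2)%:E)%E.
Proof.
move=> M1; have K1 : 1 <= expR (4 * expR 1) :> R.
  by rewrite -expR0 ler_expR mulr_ge0 ?expR_ge0.
(* The quadratic bound needs [tau = 2 * M <= 1 / 2]. On [(1/4, 1]] the exponential bound is at most
   a constant, and [1 <= 16 * M ^+ 2]. *)
have [M4|M4] := leP M (1 / 4).
  have eM : expR M <= 1 + 2 * M.
    have := expR_ge1Dx (- M); rewrite expRN => h.
    have e0 := expR_gt0 M; set e := expR M in h e0 *.
    have : e * (1 - M) <= 1 by have := ler_wpM2l (ltW e0) h; rewrite mulfV ?gt_eqF.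
    have := M0; nra.
  apply: (@le_trans _ _ (4 * (2 * M) ^+ 2)%:E).
    apply: (@chi2_le_sqr _ _ R nu n P p mp p0 Pp).
      by have := M0; move=> ?; apply/andP; split; lra.
    exact: le_trans eM.
  rewrite lee_fin; have := sqr_ge0 M; nra.
apply: le_trans (@chi2_le_expR _ _ R nu n P p mp p0 Pp (expR 1 - 1) M M0 _ _) _ => //.
  by apply: (le_trans trace_exp); rewrite addrC subrK ler_expR.
rewrite lee_fin; apply: (@le_trans _ _ (expR (4 * expR 1))).
  have : expR (2 * (1 + M) * (expR 1 - 1)) <= expR (4 * expR 1).
    have e1 := expR_ge1Dx (1 : R).
    by rewrite ler_expR; have := M0; nra.
  lra.
have : 1 <= 16 * M ^+ 2 by nra.
have := expR_gt0 (4 * expR 1 : R); nra.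
Qed.

Lemma poisson_density_le_max (x : R) k : 0 <= x -> poisson_density x k <= max_poisson k.
Proof.
move=> x0; rewrite /poisson_density /max_poisson mulrAC ler_wpM2r ?invr_ge0//.
have [->|k0] := posnP k.
  by rewrite !expr0 oppr0 expR0 !mul1r -expR0 ler_expR oppr_le0.
have kR : 0 < k%:R :> R by rewrite ltr0n.
have h : (x / k%:R) ^+ k <= expR (x - k%:R).
  have -> : x - k%:R = k%:R * (x / k%:R - 1) by field; rewrite gt_eqF.
  rewrite expRM_natl lerXn2r ?nnegrE ?divr_ge0 ?expR_ge0//.
  by have := expR_ge1Dx (x / k%:R - 1); rewrite addrC subrK.
have -> : x ^+ k = (x / k%:R) ^+ k * k%:R ^+ k.
  by rewrite -exprMn divfK// gt_eqF.
apply: (@le_trans _ _ (expR (x - k%:R) * k%:R ^+ k * expR (- x))).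
  by rewrite ler_wpM2r ?expR_ge0// ler_wpM2r// exprn_ge0.
by rewrite mulrAC -expRD mulrC addrAC subrr add0r.
Qed.

(** The mass at [k] increases with the rate up to [k], here through
    [(x / M) ^+ k <= expR (x - M)]. *)
Lemma poisson_density_le_tail (x : R) k : 0 < M -> 0 <= x <= M -> M <= k%:R ->
  poisson_density x k <= poisson_density M k.
Proof.
move=> Mpos /andP[x0 xM] Mk; rewrite /poisson_density ![_ / _ * _]mulrAC.
rewrite ler_wpM2r ?invr_ge0//.
have h : (x / M) ^+ k <= expR (x - M).
  apply: (@le_trans _ _ (expR (x / M - 1) ^+ k)).
    rewrite lerXn2r ?nnegrE ?divr_ge0 ?expR_ge0//.
    by have := expR_ge1Dx (x / M - 1); rewrite addrC subrK.
  have -> : x - M = M * (x / M - 1) by field; rewrite gt_eqF.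
  rewrite -expRM_natl ler_expR.
  have : x / M <= 1 by rewrite ler_pdivrMr// mul1r.
  nra.
have -> : x ^+ k = (x / M) ^+ k * M ^+ k by rewrite -exprMn divfK// gt_eqF.
apply: (@le_trans _ _ (expR (x - M) * M ^+ k * expR (- x))).
  by rewrite ler_wpM2r ?expR_ge0// ler_wpM2r// exprn_ge0.
by rewrite mulrAC -expRD mulrC addrAC subrr add0r.
Qed.

Let head k : R := if k%:R <= M then (Num.sqrt k.+1%:R)^-1 else 0.

Let head0 k : 0 <= head k.
Proof. by rewrite /head; case: ifP => // _; rewrite invr_ge0 sqrtr_ge0. Qed.

(** The second bound drives the induction while terms are nonzero, by [1 / sqrt (K + 1) <= 2 * (sqrt
    (K + 1) - sqrt K)]; afterwards the sum no longer grows and the first bound persists. *)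
Let sum_head K : \sum_(0 <= k < K) head k <= 2 * Num.sqrt (M + 1) /\
  (K%:R <= M + 1 -> \sum_(0 <= k < K) head k <= 2 * Num.sqrt K%:R).
Proof.
elim: K => [|K [IH1 IH2]].
  by rewrite big_geq// sqrtr0 mulr0 mulr_ge0 ?sqrtr_ge0.
rewrite big_nat_recr//= /head; have M0' := M0.
have [KM|KM] := leP K%:R M; last first.
  rewrite addr0; split=> // h; exfalso; move: h KM; rewrite -natr1; lra.
have h : \sum_(0 <= k < K) head k + (Num.sqrt K.+1%:R)^-1 <= 2 * Num.sqrt K.+1%:R.
  have K1 : K%:R <= M + 1 by lra.
  apply: (le_trans (lerD (IH2 K1) (lexx _))).
  have s0 := sqrtr_ge0 (K%:R : R).
  have t0 : 0 < Num.sqrt K.+1%:R :> R by rewrite sqrtr_gt0 ltr0n.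
  have ss : Num.sqrt K%:R ^+ 2 = K%:R :> R by rewrite sqr_sqrtr.
  have tt : Num.sqrt K.+1%:R ^+ 2 = K%:R + 1 :> R by rewrite sqr_sqrtr// natr1.
  set s := Num.sqrt K%:R in s0 ss *; set t := Num.sqrt K.+1%:R in t0 tt *.
  rewrite -(ler_pM2r t0) mulrDl mulVf ?gt_eqF//.
  have := sqr_ge0 (s - t); nra.
split=> // ; apply: (le_trans h); rewrite ler_pM2l// ler_sqrt -?natr1; lra.
Qed.

Let integral_head : (\int[nu]_k (head k)%:E <= (2 * Num.sqrt (M + 1))%:E)%E.
Proof.
rewrite ge0_integral_count => [|k]; last by rewrite lee_fin.
apply: lime_le; first by apply: is_cvg_nneseries => k _ _; rewrite lee_fin.
by apply: nearW => K; rewrite sumEFin lee_fin; have [] := sum_head K.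
Qed.

Lemma poisson_chi2_large : 1 < M ->
  (chi2 (permuted_prod P) (iid_mean_prod P) <=
    (expR (16 * M `^ (3 / 2)) - 1)%:E)%E.
Proof.
move=> M1; have Mpos : 0 < M by lra.
pose s := Num.sqrt M.
have s0 : 0 <= s by exact: sqrtr_ge0.
have ss : s ^+ 2 = M by rewrite sqr_sqrtr// ltW.
(* The envelope is [head] up to [M] and the density at rate [M] beyond. Its mass is at most
   [2 * sqrt (M + 1) + 1], hence [tau = 4 * s]. *)
have tr : mean_trace P p <= 1 + 4 * s.
  apply: (@mean_trace_le_envelope _ _ R nu n P p mp p0 Pp
    (fun k => head k + expR (- M) * (M ^+ k / k`!%:R))) => //.
    move=> i k; have li := lM i; have /andP[a b] := li.
    have t0 : 0 <= expR (- M) * (M ^+ k / k`!%:R).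
      by rewrite mulr_ge0 ?expR_ge0// divr_ge0// exprn_ge0.
    rewrite /head; have [kM|kM] := leP k%:R M.
      rewrite -[leLHS]addr0 lerD//.
      apply: (le_trans (poisson_density_le_max k a)).
      by rewrite -[leRHS]mul1r ler_pdivlMr ?sqrtr_gt0 ?ltr0n// max_poisson_le.
    rewrite add0r mulrC; exact: poisson_density_le_tail (ltW kM).
  under eq_integral do rewrite EFinD.
  rewrite ge0_integralD//; last 2 first.
  - by move=> k _; rewrite lee_fin.
  - by move=> k _; rewrite lee_fin mulr_ge0 ?expR_ge0// divr_ge0// exprn_ge0.
  rewrite integral_exp_coeff ?expR_ge0// -expRD addNr expR0.
  apply: (le_trans (leeD2r _ integral_head)).
  rewrite -EFinD lee_fin.
  have : Num.sqrt (M + 1) <= 2 * s.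
    rewrite -ler_sqr ?nnegrE ?sqrtr_ge0 ?mulr_ge0// sqr_sqrtr; last by lra.
    by rewrite exprMn ss; lra.
  lra.
apply: le_trans (@chi2_le_expR _ _ R nu n P p mp p0 Pp (4 * s) M M0 tr overlap_poisson) _.
rewrite lee_fin lerD2r ler_expR.
have -> : M `^ (3 / 2) = M * s.
  have -> : 3 / 2 = 1 + 2^-1 :> R by field.
  rewrite powRD; last by apply/implyP => _; rewrite gt_eqF.
  by rewrite powRr1 ?ltW// powR12_sqrt// ltW.
nra.
Qed.

End sample.
End poisson.

Theorem corollary1p3 (R : realType) :
  (* Gaussian family *)
  (exists mu_c C1 C2 : R, 0 < mu_c /\
    forall mu : R, 0 < mu ->
      (mu <= mu_c -> perm_chi2_le (gaussian_family mu) (C1 * mu ^+ 4)) /\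
      (mu_c < mu ->
        perm_chi2_le (gaussian_family mu) (expR (C2 * mu ^+ 3) - 1))) /\
  (* Gaussian family with small support *)
  (exists mu_c C1 C2 : R, 0 < mu_c /\
    forall (mu : R) (Theta : {fset R}),
      (mu <= mu_c ->
        perm_chi2_le (gaussian_subfamily mu Theta) (C1 * mu ^+ 4)) /\
      (mu_c < mu ->
        perm_chi2_le (gaussian_subfamily mu Theta)
          (expR (C2 * (#|` Theta|%:R * mu ^+ 2)) - 1))) /\
  (* Bernoulli family *)
  (exists eps_c C1 C2 : R, 0 < eps_c < 1 / 2 /\
    forall eps : R, 0 < eps <= 1 / 2 ->
      (eps_c <= eps ->
        perm_chi2_le (bernoulli_family eps) (C1 * (1 - 2 * eps) ^+ 4)) /\
      (eps < eps_c ->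
        perm_chi2_le (bernoulli_family eps) (C2 * (1 / eps)))) /\
  (* Poisson family *)
  (exists C1 C2 : R,
    forall M : R,
      (M <= 1 -> perm_chi2_le (poisson_family M) (C1 * M ^+ 2)) /\
      (1 < M ->
        perm_chi2_le (poisson_family M) (expR (C2 * (M `^ (3 / 2))) - 1))).
Proof.
split; [|split; [|split]].
(* Up to 1/4, [6 * mu ^+ 2 <= 1 / 2]; beyond it, lower powers of [mu] are absorbed into the
   constants. *)
- exists (1 / 4), 144, 204; split=> [|mu mu0]; first by lra.
  split=> hmu n P HP; have /choice[th Hth] :
      forall i, exists t, `|t| <= mu /\ P i = gaussian t.
  + by move=> i; have [t tmu <-] := HP i; exists t.
  + by apply: (gaussian_chi2_small (th := th)) => // i; have [] := Hth i.
  + by move=> i; have [t tmu <-] := HP i; exists t.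
  + by apply: (gaussian_chi2_large (th := th)) => // i; have [] := Hth i.
- exists (1 / 4), 144, 34; split=> [|mu Theta]; first by lra.
  split=> hmu n P HP; have /choice[th Hth] :
      forall i, exists t, [/\ `|t| <= mu, t \in Theta & P i = gaussian t].
  + by move=> i; have [t [tmu tT] <-] := HP i; exists t.
  + by apply: (gaussian_chi2_small (th := th)) => // i; have [] := Hth i.
  + by move=> i; have [t [tmu tT] <-] := HP i; exists t.
  + by apply: (gaussian_chi2_finite (th := th)) => // i; have [] := Hth i.
- exists (3 / 8), 100, 1; split=> [|eps eps0]; first by apply/andP; split; lra.
  split=> heps n P HP; have /choice[q Hq] :
      forall i, exists q, eps <= q <= 1 - eps /\ P i = bern q.
  + by move=> i; have [q qe <-] := HP i; exists q.
  + by apply: (bernoulli_chi2_small (q := q)) => // i; have [] := Hq i.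
  + by move=> i; have [q qe <-] := HP i; exists q.
  + by apply: (bernoulli_chi2_large (q := q)) => // i; have [] := Hq i.
- exists (16 * expR (4 * expR 1)), 16 => M.
  split=> hM n P HP; have /choice[l Hl] :
      forall i, exists l, 0 <= l <= M /\ P i = poi l.
  + by move=> i; have [l lM <-] := HP i; exists l.
  + by apply: (poisson_chi2_small (l := l)) => // i; have [] := Hl i.
  + by move=> i; have [l lM <-] := HP i; exists l.
  + by apply: (poisson_chi2_large (l := l)) => // i; have [] := Hl i.
Qed.
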